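(* Let $G$ be a commutative-transitive discrete group. Then $H^n(\ell^1(G),I_0(G)')=0$ for every $n\ge1$.
   Context: For a discrete group $G$, $\ell^1(G)$ is its convolution algebra with standard basis $(e_g)_{g\in G}$; the augmentation character $\varepsilon:\ell^1(G)\to\mathbb C$ sends each $e_g$ to $1$, and the augmentation ideal is $I_0(G)=\ker\varepsilon$, a Banach $\ell^1(G)$-bimodule under multiplication; $I_0(G)'$ is its dual with the adjoint bimodule structure. $G$ is commutative-transitive if the centralizer of every element of $G\setminus\{e\}$ is abelian. $H^n(A,M)$ denotes Hochschild cohomology of the Banach algebra $A$ with coefficients in the Banach bimodule $M$, computed from the complex of bounded $n$-linear maps $A^n\to M$ with the standard Hochschild coboundary. *)

(* Defs.v *)
From HB Require Import structures.
From mathcomp Require Import all_boot all_order all_algebra.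
From mathcomp Require Import boolp classical_sets reals constructive_ereal ereal esum.
From mathcomp Require Import complex.

Set Implicit Arguments.
Unset Strict Implicit.
Unset Printing Implicit Defensive.
Import Order.TTheory GRing.Theory Num.Theory.
Local Open Scope ring_scope.

(* A (discrete, possibly infinite) group.  The carrier is a choiceType, which
   is no restriction classically; no topology is involved (discrete). *)
Record discGroup := DiscGroup {
  gcar :> choiceType;
  gmul : gcar -> gcar -> gcar;
  ginv : gcar -> gcar;
  gone : gcar;
  gmulA : associative gmul;
  gmul1g : left_id gone gmul;
  gmulVg : left_inverse gone ginv gmul }.

Definition comm_transitive (G : discGroup) : Prop :=
  forall x : G, x <> gone G ->
  forall y z : G, gmul x y = gmul y x -> gmul x z = gmul z x ->
  gmul y z = gmul z y.

Section L1.
Variables (R : realType) (G : discGroup).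
Local Notation C := R[i].

(* sum over G of a real-valued function (meaningful for absolutely summable ones) *)
Definition rsum (f : G -> R) : R :=
  fine (\esum_(x in [set: G]) (Num.max (f x) 0)%:E)
  - fine (\esum_(x in [set: G]) (Num.max (- f x) 0)%:E).

Definition csum (f : G -> C) : C :=
  Complex (rsum (fun x => complex.Re (f x))) (rsum (fun x => complex.Im (f x))).

Definition is_l1 (f : G -> C) : Prop :=
  summable [set: G] (fun x => (Normc.normc (f x))%:E).

Definition l1norm (f : G -> C) : R :=
  fine (\esum_(x in [set: G]) (Normc.normc (f x))%:E).

(* convolution product: (f * g)(x) = sum_y f(y) g(y^-1 x); e_g * e_h = e_{gh} *)
Definition conv (f g : G -> C) : G -> C :=
  fun x => csum (fun y => f y * g (gmul (ginv y) x)).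

Definition augm (f : G -> C) : C := csum f.

Definition in_I0 (f : G -> C) : Prop := is_l1 f /\ augm f = 0.

Definition fadd (f g : G -> C) : G -> C := fun x => f x + g x.
Definition fscale (c : C) (f : G -> C) : G -> C := fun x => c * f x.

(* Elements of the dual I_0(G)' are represented by functionals on G -> C whose
   restriction to I_0(G) is linear and bounded; only values on I_0(G) matter. *)
Definition functional := (G -> C) -> C.

Definition is_dualI0 (phi : functional) : Prop :=
  (forall f g (c : C), in_I0 f -> in_I0 g ->
     phi (fadd f (fscale c g)) = phi f + c * phi g) /\
  exists K : R, forall f, in_I0 f -> Normc.normc (phi f) <= K * l1norm f.

Definition deq (phi psi : functional) : Prop :=
  forall f, in_I0 f -> phi f = psi f.

Definition lact (a : G -> C) (phi : functional) : functional :=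
  fun x => phi (conv x a).
Definition ract (phi : functional) (a : G -> C) : functional :=
  fun x => phi (conv a x).

Definition cochain (n : nat) := ('I_n -> G -> C) -> functional.

Definition all_l1 n (a : 'I_n -> G -> C) : Prop := forall i, is_l1 (a i).

Definition upd n (a : 'I_n -> G -> C) (i : 'I_n) (b : G -> C) : 'I_n -> G -> C :=
  fun j => if j == i then b else a j.

Definition bounded_cochain n (T : cochain n) : Prop :=
  [/\ (forall a, all_l1 a -> is_dualI0 (T a)),
      (forall a i b b' (c : C), all_l1 a -> is_l1 b -> is_l1 b' ->
         deq (T (upd a i (fadd b (fscale c b'))))
             (fun x => T (upd a i b) x + c * T (upd a i b') x)) &
      exists K : R, forall a x, all_l1 a -> in_I0 x ->
         Normc.normc (T a x) <= K * (\prod_(i < n) l1norm (a i)) * l1norm x].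

Definition ctail n (a : 'I_n.+1 -> G -> C) : 'I_n -> G -> C :=
  fun j => a (inord j.+1).
Definition cinit n (a : 'I_n.+1 -> G -> C) : 'I_n -> G -> C :=
  fun j => a (inord j).
Definition cmerge n (a : 'I_n.+1 -> G -> C) (i : 'I_n) : 'I_n -> G -> C :=
  fun j => if (j < i)%N then a (inord j)
           else if (j == i :> nat) then conv (a (inord j)) (a (inord j.+1))
           else a (inord j.+1).

Definition coboundary n (T : cochain n) : cochain n.+1 :=
  fun a x =>
    lact (a ord0) (T (ctail a)) x
    + \sum_(i < n) (-1) ^+ i.+1 * T (cmerge a i) x
    + (-1) ^+ n.+1 * ract (T (cinit a)) (a ord_max) x.

(* H^n(l^1(G), I_0(G)') = 0 : every bounded n-cocycle is the coboundary of a
   bounded (n-1)-cochain (stated for n = m+1). *)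
Definition Hvanishes (m : nat) : Prop :=
  forall T : cochain m.+1, bounded_cochain T ->
    (forall a, all_l1 a -> deq (coboundary T a) (fun _ => 0)) ->
    exists S : cochain m, bounded_cochain S /\
      forall a, all_l1 a -> deq (T a) (coboundary S a).

End L1.

(* Main.v *)
(* Restricting to G \ {e} identifies I_0(G), twisted so that G acts by
   conjugation, with l^1(G \ {e}); its dual is l^oo(G \ {e}).  Centralizers of
   nontrivial elements are abelian, hence amenable, so translating an invariant
   mean along each conjugacy class gives means M_y on l^oo(G), for y <> e, with
   M_(k y k^-1) = k . M_y.  Averaging the first argument of a homogeneous
   cocycle against M_y is a contracting homotopy that respects equivariance.
   The resulting primitive, a bounded function of group elements, extends to
   l^1(G) by iterated summation, and the identity T = dS, a relation between
   bounded multilinear maps, need only be checked on point masses. *)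
Require Import Defs.
From HB Require Import structures.
From mathcomp Require Import all_boot all_order all_algebra finmap.
From mathcomp Require Import boolp classical_sets cardinality fsbigop.
From mathcomp Require Import reals constructive_ereal ereal.
From mathcomp Require Import filter topology normedtype esum complex ring lra.

Set Implicit Arguments.
Unset Strict Implicit.
Unset Printing Implicit Defensive.
Import Order.TTheory GRing.Theory Num.Theory numFieldNormedType.Exports.
Local Open Scope classical_set_scope.
Local Open Scope ring_scope.

Local Notation cabs := Normc.normc.
Local Notation Re := complex.Re.
Local Notation Im := complex.Im.

(** A single mean on l^oo(G) invariant under all translations would make G amenable, which already
    fails for free groups, although these are commutative-transitive. The way out is to let the mean
    depend on the point of evaluation y: equivariance then asks only for invariance under the
    stabilizer of y for conjugation, its centralizer. The point y = e, whose stabilizer is all of G,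
    is harmless because the functions to be averaged vanish there; this is where I_0(G) differs from
    l^1(G). The homotopy is read off from the cocycle identity at (x^-1, t_0, ..., t_n). Once the
    vectors of evaluation are translated by x, the term in which x^-1 acts on the module no longer
    depends on x and is T at t. Averaging over x keeps it, since means fix constants, and turns the
    other terms into the coboundary of the primitive. Equivariance enters only in the term where
    x^-1 absorbs t_0. *)

(** * Group identities and conjugation *)

Section Groups.
Variable G : discGroup.

Lemma gmulgV (x : G) : gmul x (ginv x) = gone G.
Proof.
rewrite -[LHS]gmul1g -{1}(gmulVg (ginv x)) -gmulA.
by rewrite (gmulA (ginv x)) gmulVg gmul1g gmulVg.
Qed.

Lemma gmulg1 (x : G) : gmul x (gone G) = x.
Proof. by rewrite -(gmulVg x) gmulA gmulgV gmul1g. Qed.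

Lemma gmulKg (x y : G) : gmul (ginv x) (gmul x y) = y.
Proof. by rewrite gmulA gmulVg gmul1g. Qed.

Lemma gmulVKg (x y : G) : gmul x (gmul (ginv x) y) = y.
Proof. by rewrite gmulA gmulgV gmul1g. Qed.

Definition conjugate (k y : G) : G := gmul k (gmul y (ginv k)).

Lemma ginv_eq (x y : G) : gmul x y = gone G -> ginv x = y.
Proof. by move=> e; rewrite -(gmulg1 (ginv x)) -e gmulA gmulVg gmul1g. Qed.

Lemma ginvM (x y : G) : ginv (gmul x y) = gmul (ginv y) (ginv x).
Proof. by apply: ginv_eq; rewrite -gmulA (gmulA y) gmulgV gmul1g gmulgV. Qed.

Lemma ginvK (x : G) : ginv (ginv x) = x.
Proof. by apply: ginv_eq; exact: gmulVg. Qed.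

Lemma conjugateM (k l y : G) : conjugate (gmul k l) y = conjugate k (conjugate l y).
Proof. by rewrite /conjugate ginvM !gmulA. Qed.

Lemma conjugate1 (y : G) : conjugate (gone G) y = y.
Proof. by rewrite /conjugate gmul1g (ginv_eq (gmul1g (gone G))) gmulg1. Qed.

Lemma conjugateK (k y : G) : conjugate (ginv k) (conjugate k y) = y.
Proof. by rewrite -conjugateM gmulVg conjugate1. Qed.

Lemma conjugateg1 (k : G) : conjugate k (gone G) = gone G.
Proof. by rewrite /conjugate gmul1g gmulgV. Qed.

Lemma commute_conjugate (k y : G) :
  conjugate k y = y -> gmul k y = gmul y k.
Proof.
by move=> e; rewrite -{2}e /conjugate -!gmulA gmulVg gmulg1.
Qed.

End Groups.

(** Makes ordered products of group elements available, as used by [gprod] and [big_merge]. *)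
HB.instance Definition _ (G : discGroup) :=
  Monoid.isLaw.Build G (gone G) (@gmul G) (@gmulA G) (@gmul1g G) (@gmulg1 G).

(** * Sums over a group *)

Section RealSums.
Variables (R : realType) (G : discGroup).
Implicit Types (p q f g : G -> R) (c : R).

(** [fine] sends a divergent sum to 0; [rsummable] excludes this, and for signed p it means absolute
    summability. *)
Definition sum_ge0 p : R := fine (\esum_(x in [set: G]) (p x)%:E).
Definition rsummable p : Prop := summable [set: G] (fun x => (p x)%:E).

Lemma rsummable_le p q :
  (forall x, `|p x| <= `|q x|) -> rsummable q -> rsummable p.
Proof.
move=> pq; apply: le_lt_trans; apply: le_esum => x _.
by rewrite !abse_EFin lee_fin.
Qed.

Lemma sum_ge0E p : (forall x, 0 <= p x) -> rsummable p ->
  \esum_(x in [set: G]) (p x)%:E = (sum_ge0 p)%:E.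
Proof.
move=> p0; rewrite /rsummable summableE => sp; rewrite /sum_ge0 fineK//.
rewrite (eq_esum (b := fun x => `|(p x)%:E|%E))// => x _.
by rewrite abse_EFin ger0_norm.
Qed.

Lemma rsummableP p c : (forall x, 0 <= p x) ->
  (\esum_(x in [set: G]) (p x)%:E <= c%:E)%E -> rsummable p.
Proof.
move=> p0 pc; apply: (le_lt_trans _ (ltry c)); apply: le_trans pc.
by apply: le_esum => x _; rewrite abse_EFin ger0_norm.
Qed.

Lemma sum_ge0_ge0 p : (forall x, 0 <= p x) -> 0 <= sum_ge0 p.
Proof. by move=> p0; apply/fine_ge0/esum_ge0 => x _; rewrite lee_fin. Qed.

Lemma sum_ge0_le p c : (forall x, 0 <= p x) ->
  (\esum_(x in [set: G]) (p x)%:E <= c%:E)%E -> sum_ge0 p <= c.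
Proof.
by move=> p0 pc; have := pc; rewrite sum_ge0E ?lee_fin//; exact: rsummableP pc.
Qed.

Lemma ler_sum_ge0 p q : (forall x, 0 <= p x) -> (forall x, p x <= q x) ->
  rsummable q -> sum_ge0 p <= sum_ge0 q.
Proof.
move=> p0 pq sq; apply: sum_ge0_le => //.
rewrite -sum_ge0E//; last by move=> x; exact: le_trans (pq x).
by apply: le_esum => x _; rewrite lee_fin.
Qed.

Lemma rsummableD p q : rsummable p -> rsummable q ->
  rsummable (fun x => p x + q x).
Proof. by move=> sp sq; exact: summableD sp sq. Qed.

Lemma sum_ge0D p q : (forall x, 0 <= p x) -> (forall x, 0 <= q x) ->
  rsummable p -> rsummable q ->
  sum_ge0 (fun x => p x + q x) = sum_ge0 p + sum_ge0 q.
Proof.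
move=> p0 q0 sp sq; apply: EFin_inj.
rewrite EFinD -!sum_ge0E//; first last.
- exact: rsummableD.
- by move=> x; rewrite addr_ge0.
by rewrite -esumD//= => x _; rewrite lee_fin.
Qed.

Lemma esum_scale_le c p : 0 <= c -> (forall x, 0 <= p x) -> rsummable p ->
  (\esum_(x in [set: G]) (c * p x)%:E <= (c * sum_ge0 p)%:E)%E.
Proof.
move=> c0 p0 sp; apply: ge_ereal_sup => _ [X [finX XT]] <-.
rewrite fsumEFin// lee_fin fsbig_finite//= -big_distrr/=.
apply: ler_wpM2l => //; rewrite -lee_fin -sum_ge0E//.
by apply: esum_ge; exists X => //; rewrite fsumEFin// fsbig_finite.
Qed.

Lemma rsummableZ c p : rsummable p -> rsummable (fun x => c * p x).
Proof.
move=> sp; have sp' : rsummable (fun x => `|p x|).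
  by apply: rsummable_le sp => x; rewrite normr_id.
apply: (@rsummable_le _ (fun x => `|c| * `|p x|)).
  by move=> x; rewrite !normrM !normr_id.
apply: (@rsummableP _ (`|c| * sum_ge0 (fun x => `|p x|))).
  by move=> x; rewrite mulr_ge0.
exact: esum_scale_le.
Qed.

Lemma sum_ge0Z c p : 0 <= c -> (forall x, 0 <= p x) -> rsummable p ->
  sum_ge0 (fun x => c * p x) = c * sum_ge0 p.
Proof.
move=> c0 p0 sp; have [->|cN0] := eqVneq c 0.
  rewrite mul0r /sum_ge0 esum1// => x _; by rewrite mul0r.
have cp : 0 < c by rewrite lt_def cN0.
have le1 d q : 0 <= d -> (forall x, 0 <= q x) -> rsummable q ->
    sum_ge0 (fun x => d * q x) <= d * sum_ge0 q.
  move=> d0 q0 sq; apply: sum_ge0_le; last exact: esum_scale_le.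
  by move=> x; rewrite mulr_ge0.
(* The reverse inequality is [le1] for the factor c^-1 and the family c * p. *)
apply/eqP; rewrite eq_le le1//= -ler_pdivlMl//.
have {1}-> : p = fun x => c^-1 * (c * p x).
  by apply/funext => x; rewrite mulKf.
apply: le1; first by rewrite invr_ge0.
  by move=> x; rewrite mulr_ge0.
exact: rsummableZ.
Qed.

Lemma rsumE f : rsum f =
  sum_ge0 (fun x => Num.max (f x) 0) - sum_ge0 (fun x => Num.max (- f x) 0).
Proof. by []. Qed.

Lemma rsummable_pos f : rsummable f -> rsummable (fun x => Num.max (f x) 0).
Proof.
apply: rsummable_le => x.
by rewrite ger0_norm ?le_max ?lexx ?orbT// ge_max normr_ge0 ler_norm.
Qed.

Lemma rsummableN f : rsummable f -> rsummable (fun x => - f x).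
Proof. by apply: rsummable_le => x; rewrite normrN. Qed.

(** Frees [rsum] from the particular splitting into positive and negative parts: adding q to the
    positive part of p - q, or p to its negative part, gives the pointwise maximum of p and q both
    times. Linearity of [rsum] rests on this. *)
Lemma rsumB_ge0 p q : (forall x, 0 <= p x) -> (forall x, 0 <= q x) ->
  rsummable p -> rsummable q ->
  rsum (fun x => p x - q x) = sum_ge0 p - sum_ge0 q.
Proof.
move=> p0 q0 sp sq; rewrite rsumE; set P := sum_ge0 _; set N := sum_ge0 _.
suff : P + sum_ge0 q = N + sum_ge0 p by lra.
have spq : rsummable (fun x => p x - q x).
  by apply: rsummableD => //; exact: rsummableN.
have sqp : rsummable (fun x => - (p x - q x)) by exact: rsummableN.
have m0 (a : R) : 0 <= Num.max a 0 by rewrite le_max lexx orbT.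
rewrite -!sum_ge0D//; try exact: rsummable_pos.
congr sum_ge0; apply/funext => x.
by case: (lerP (p x - q x) 0); case: (lerP (- (p x - q x)) 0); lra.
Qed.

Lemma rsumD f g : rsummable f -> rsummable g ->
  rsum (fun x => f x + g x) = rsum f + rsum g.
Proof.
move=> sf sg; have m0 (a : R) : 0 <= Num.max a 0 by rewrite le_max lexx orbT.
have sf1 := rsummable_pos sf; have sg1 := rsummable_pos sg.
have sf2 := rsummable_pos (rsummableN sf).
have sg2 := rsummable_pos (rsummableN sg).
have -> : (fun x => f x + g x) = fun x =>
    (Num.max (f x) 0 + Num.max (g x) 0)
    - (Num.max (- f x) 0 + Num.max (- g x) 0).
  apply/funext => x; case: (lerP (f x) 0); case: (lerP (- f x) 0);
  by case: (lerP (g x) 0); case: (lerP (- g x) 0); lra.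
rewrite rsumB_ge0//; try (by move=> x; rewrite addr_ge0); try exact: rsummableD.
by rewrite !sum_ge0D// !rsumE; ring.
Qed.

Lemma rsumN f : rsum (fun x => - f x) = - rsum f.
Proof.
rewrite !rsumE opprB; congr (_ - _).
by congr sum_ge0; apply/funext => x; rewrite opprK.
Qed.

Lemma rsumZ c f : rsummable f -> rsum (fun x => c * f x) = c * rsum f.
Proof.
move=> sf; have m0 (a : R) : 0 <= Num.max a 0 by rewrite le_max lexx orbT.
have sf1 := rsummable_pos sf; have sf2 := rsummable_pos (rsummableN sf).
wlog c0 : c / 0 <= c.
  move=> H; case: (lerP 0 c) => [/H//|c0].
  have -> : (fun x => c * f x) = fun x => - ((- c) * f x).
    by apply/funext => x; rewrite mulNr opprK.
  by rewrite rsumN H ?oppr_ge0 1?ltW// mulNr opprK.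
by rewrite !rsumE mulrBr -!sum_ge0Z//; congr (_ - _); congr sum_ge0;
  apply/funext => x; rewrite maxr_pMr// mulr0// mulrN.
Qed.

Lemma rsum_norm f : rsummable f -> `|rsum f| <= sum_ge0 (fun x => `|f x|).
Proof.
move=> sf; have m0 (a : R) : 0 <= Num.max a 0 by rewrite le_max lexx orbT.
have sf1 := rsummable_pos sf; have sf2 := rsummable_pos (rsummableN sf).
have -> : (fun x => `|f x|) = fun x => Num.max (f x) 0 + Num.max (- f x) 0.
  apply/funext => x; case: (lerP (f x) 0); case: (lerP (- f x) 0) => a b.
  - have -> : f x = 0 by lra.
    by rewrite normr0 addr0.
  - by rewrite ler0_norm// add0r.
  - by rewrite gtr0_norm// addr0.
  - by lra.
rewrite sum_ge0D// rsumE.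
have := sum_ge0_ge0 (fun x => m0 (f x)).
have := sum_ge0_ge0 (fun x => m0 (- f x)).
by rewrite ler_norml; lra.
Qed.

Lemma sum_ge0_single (y : G) c : 0 <= c ->
  rsummable (fun x => if x == y then c else 0) /\
  sum_ge0 (fun x => if x == y then c else 0) = c.
Proof.
move=> c0; have pos x : 0 <= if x == y then c else 0 by case: ifP.
have E : \esum_(x in [set: G]) (if x == y then c else 0)%:E = c%:E.
  rewrite -(@esum_set1 _ _ y (fun=> c%:E)) ?lee_fin//.
  rewrite [RHS]esum_mkcond; apply: eq_esum => x _.
  by rewrite in_set1 /=; case: ifP.
split; last by rewrite /sum_ge0 E.
by apply: (@rsummableP _ c) => //; rewrite E.
Qed.

Lemma rsum_single (y : G) c : rsum (fun x => if x == y then c else 0) = c.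
Proof.
wlog c0 : c / 0 <= c.
  move=> H; case: (lerP 0 c) => [/H//|c0].
  have -> : (fun x => if x == y then c else 0) =
            fun x => - (if x == y then - c else 0).
    by apply/funext => x; case: ifP; rewrite ?opprK ?oppr0.
  by rewrite rsumN H ?opprK// oppr_ge0 ltW.
have [s1 e1] := sum_ge0_single y c0.
have [s2 e2] := sum_ge0_single y (lexx (0:R)).
have -> : (fun x => if x == y then c else 0) =
   fun x => (if x == y then c else 0) - (if x == y then 0 else 0).
  by apply/funext => x; case: ifP; rewrite subr0.
by rewrite rsumB_ge0 ?e1 ?e2 ?subr0// => x; case: ifP.
Qed.

(** The supremum that defines the sum is nearly attained on a finite set; this is the approximation
    by finite supports behind [l1_delta_ind]. *)
Lemma sum_ge0_tail p (e : R) : (forall x, 0 <= p x) -> rsummable p -> 0 < e ->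
  exists s : seq G, sum_ge0 (fun x => if x \in s then 0 else p x) <= e.
Proof.
move=> p0 sp e0.
have : ((sum_ge0 p - e)%:E < \esum_(x in [set: G]) (p x)%:E)%E.
  by rewrite sum_ge0E// lte_fin; lra.
move=> /ereal_sup_gt[_ [X [finX _] <-]] lt_e.
pose s : seq G := fset_set X; exists s.
pose q x := if x \in s then p x else 0.
have q0 x : 0 <= q x by rewrite /q; case: ifP.
have sq : rsummable q.
  by apply: rsummable_le sp => x; rewrite !ger0_norm// /q; case: ifP.
have p'0 x : 0 <= (if x \in s then 0 else p x) by case: ifP.
have sp' : rsummable (fun x => if x \in s then 0 else p x).
  by apply: rsummable_le sp => x; rewrite !ger0_norm//; case: ifP.
have Ep : sum_ge0 p = sum_ge0 q + sum_ge0 (fun x => if x \in s then 0 else p x).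
  rewrite -sum_ge0D//; congr sum_ge0; apply/funext => x.
  by rewrite /q; case: ifP; rewrite ?addr0 ?add0r.
suff : sum_ge0 p - e < sum_ge0 q by rewrite Ep; lra.
rewrite -lte_fin (lt_le_trans lt_e)// -sum_ge0E//.
apply: esum_ge; exists X => //.
rewrite !fsbig_finite//= big_seq [leRHS]big_seq; apply: lee_sum => x xX.
by rewrite lee_fin /q /s xX.
Qed.

(** Tonelli: both iterated sums are sums over pairs, matched by swapping the coordinates. *)
Lemma exchange_esum (a : G -> G -> \bar R) : (forall x y, 0 <= a x y)%E ->
  (\esum_(x in [set: G]) \esum_(y in [set: G]) a x y =
   \esum_(y in [set: G]) \esum_(x in [set: G]) a x y)%E.
Proof.
move=> a0; rewrite !esum_esum//.
rewrite (reindex_esum ([set: G] `*`` (fun=> [set: G])) _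
  (fun z => (z.2, z.1)))//.
split => //; first by move=> [x y] [x' y'] _ _ [-> ->].
by move=> [x y] _; exists (y, x).
Qed.

Lemma esum_translate (q : G -> R) (y : G) :
  \esum_(x in [set: G]) (q (gmul (ginv y) x))%:E =
  \esum_(x in [set: G]) (q x)%:E.
Proof.
apply/esym; apply: (reindex_esum _ _ (fun x => gmul (ginv y) x)).
split=> // [x x' _ _ /(congr1 (gmul y))|x _]; first by rewrite !gmulVKg.
by exists (gmul y x) => //; rewrite gmulKg.
Qed.

(** By Tonelli the sum over x may be taken first, and translation by y leaves the sum of q
    unchanged. Each single x then inherits finiteness, its sum being at most the total. *)
Lemma sum_ge0_conv p q : (forall x, 0 <= p x) -> (forall x, 0 <= q x) ->
  rsummable p -> rsummable q ->
  [/\ forall x, rsummable (fun y => p y * q (gmul (ginv y) x)),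
      rsummable (fun x => sum_ge0 (fun y => p y * q (gmul (ginv y) x))) &
      sum_ge0 (fun x => sum_ge0 (fun y => p y * q (gmul (ginv y) x)))
        <= sum_ge0 p * sum_ge0 q].
Proof.
move=> p0 q0 sp sq.
have pq0 x y : 0 <= p y * q (gmul (ginv y) x) by rewrite mulr_ge0.
have le_tot : (\esum_(x in [set: G]) \esum_(y in [set: G])
    (p y * q (gmul (ginv y) x))%:E <= (sum_ge0 p * sum_ge0 q)%:E)%E.
  rewrite exchange_esum; last by move=> x y; rewrite lee_fin.
  rewrite mulrC; apply: le_trans (esum_scale_le (sum_ge0_ge0 q0) p0 sp).
  apply: le_esum => y _; rewrite [sum_ge0 q * _]mulrC.
  have E := esum_translate q y.
  have sq' : rsummable (fun x => q (gmul (ginv y) x)).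
    by apply: (@rsummableP _ (sum_ge0 q)) => //; rewrite E sum_ge0E.
  have <- : sum_ge0 (fun x => q (gmul (ginv y) x)) = sum_ge0 q.
    by rewrite /sum_ge0 E.
  exact: esum_scale_le.
have s1 x : rsummable (fun y => p y * q (gmul (ginv y) x)).
  apply: (@rsummableP _ (sum_ge0 p * sum_ge0 q)) => //.
  apply: le_trans le_tot.
  rewrite -(@esum_set1 _ _ x
    (fun x => \esum_(y in [set: G]) (p y * q (gmul (ginv y) x))%:E)).
  2: by apply: esum_ge0 => y _; rewrite lee_fin.
  rewrite esum_mkcond; apply: le_esum => z _; case: ifP => // _.
  by apply: esum_ge0 => y _; rewrite lee_fin.
have tot : (\esum_(x in [set: G])
    (sum_ge0 (fun y => p y * q (gmul (ginv y) x)))%:E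
      <= (sum_ge0 p * sum_ge0 q)%:E)%E.
  by apply: le_trans le_tot; apply: le_esum => x _; rewrite sum_ge0E.
split=> //; last by apply: sum_ge0_le => // x; exact: sum_ge0_ge0.
by apply: rsummableP tot => x; exact: sum_ge0_ge0.
Qed.

End RealSums.

(** * The algebra l^1(G) and its augmentation ideal *)

Section ComplexModulus.
Variable R : realType.
Implicit Types z w : R[i].

Lemma cabs_ge0 z : 0 <= cabs z.
Proof. by case: z => a b; rewrite sqrtr_ge0. Qed.

Lemma cabsD z w : cabs (z + w) <= cabs z + cabs w.
Proof. exact: le_normcD. Qed.

Lemma cabsN z : cabs (- z) = cabs z.
Proof. exact: normcN. Qed.

Lemma cabs0 : cabs (0 : R[i]) = 0.
Proof. exact: Normc.normc0. Qed.

Lemma cabs1 : cabs (1 : R[i]) = 1.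
Proof. exact: Normc.normc1. Qed.

Lemma cabsM z w : cabs (z * w) = cabs z * cabs w.
Proof. exact: Normc.normcM. Qed.

Lemma cabs_sign n z : cabs ((-1) ^+ n * z) = cabs z.
Proof.
by rewrite -signr_odd; case: odd; rewrite ?expr1 ?expr0 ?mulN1r ?mul1r ?cabsN.
Qed.

Lemma ler_abs_Re z : `|Re z| <= cabs z.
Proof.
case: z => a b /=; rewrite -sqrtr_sqr ler_sqrt ?addr_ge0 ?sqr_ge0//.
by rewrite lerDl sqr_ge0.
Qed.

Lemma ler_abs_Im z : `|Im z| <= cabs z.
Proof.
case: z => a b /=; rewrite -sqrtr_sqr ler_sqrt ?addr_ge0 ?sqr_ge0//.
by rewrite lerDr sqr_ge0.
Qed.

Lemma cabs_ReIm z : cabs z <= `|Re z| + `|Im z|.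
Proof.
case: z => a b /=; rewrite -[leRHS]ger0_norm ?addr_ge0// -sqrtr_sqr.
rewrite ler_sqrt ?sqr_ge0// sqrrD !real_normK ?num_real//.
by rewrite -addrA lerD2l lerDr mulrn_wge0// mulr_ge0.
Qed.

End ComplexModulus.

Section L1Theory.
Variables (R : realType) (G : discGroup).
Local Notation C := R[i].
Implicit Types (f g a b u : G -> C) (c : C).

Lemma l1normE f : l1norm f = sum_ge0 (fun x => cabs (f x)).
Proof. by []. Qed.

Lemma is_l1E f : is_l1 f = rsummable (fun x => cabs (f x)).
Proof. by []. Qed.

Lemma is_l1_le f (p : G -> R) : (forall x, cabs (f x) <= p x) ->
  rsummable p -> is_l1 f.
Proof.
move=> fp; apply: rsummable_le => x.
by rewrite ger0_norm ?cabs_ge0// (le_trans (fp x))// ler_norm.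
Qed.

Lemma l1norm_le f (p : G -> R) : (forall x, cabs (f x) <= p x) ->
  rsummable p -> l1norm f <= sum_ge0 p.
Proof. by move=> fp sp; apply: ler_sum_ge0 => // x; exact: cabs_ge0. Qed.

Lemma l1norm_ge0 f : 0 <= l1norm f.
Proof. by apply: sum_ge0_ge0 => x; exact: cabs_ge0. Qed.

Lemma is_l1_Re f : is_l1 f -> rsummable (fun x => Re (f x)).
Proof.
by apply: rsummable_le => x; rewrite [leRHS]ger0_norm ?cabs_ge0// ler_abs_Re.
Qed.

Lemma is_l1_Im f : is_l1 f -> rsummable (fun x => Im (f x)).
Proof.
by apply: rsummable_le => x; rewrite [leRHS]ger0_norm ?cabs_ge0// ler_abs_Im.
Qed.

Lemma is_l1D f g c : is_l1 f -> is_l1 g -> is_l1 (fadd f (fscale c g)).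
Proof.
move=> sf sg; apply: is_l1_le (rsummableD sf (rsummableZ (cabs c) sg)) => x.
by rewrite (le_trans (cabsD _ _))// cabsM.
Qed.

Lemma l1normD f g c : is_l1 f -> is_l1 g ->
  l1norm (fadd f (fscale c g)) <= l1norm f + cabs c * l1norm g.
Proof.
move=> sf sg; rewrite !l1normE -sum_ge0Z ?cabs_ge0//; last first.
  by move=> x; exact: cabs_ge0.
rewrite -sum_ge0D//; first last.
- exact: rsummableZ.
- by move=> x; rewrite mulr_ge0 ?cabs_ge0.
- by move=> x; exact: cabs_ge0.
apply: l1norm_le; last by apply: rsummableD => //; exact: rsummableZ.
by move=> x; rewrite (le_trans (cabsD _ _))// cabsM.
Qed.

Lemma csumD f g c : is_l1 f -> is_l1 g ->
  csum (fun x => f x + c * g x) = csum f + c * csum g.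
Proof.
move=> sf sg; have [fr gr] := (is_l1_Re sf, is_l1_Re sg).
have [fi gi] := (is_l1_Im sf, is_l1_Im sg); case: c => r s.
have E3 (p q h : G -> R) (k l : R) :
    rsummable p -> rsummable q -> rsummable h ->
    rsum (fun x => p x + (k * q x + l * h x)) =
    rsum p + (k * rsum q + l * rsum h).
  move=> sp sq sh; have sq' := rsummableZ k sq; have sh' := rsummableZ l sh.
  by rewrite rsumD ?rsumD ?rsumZ//; exact: rsummableD.
rewrite /csum; set u := rsum _; set v := rsum _.
have -> : u = rsum (fun x => Re (f x)) +
    (r * rsum (fun x => Re (g x)) + (- s) * rsum (fun x => Im (g x))).
  rewrite -E3//.
  rewrite /u; congr rsum; apply/funext => x.
  by case: (f x) (g x) => ? ? [? ?] /=; ring.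
have -> : v = rsum (fun x => Im (f x)) +
    (r * rsum (fun x => Im (g x)) + s * rsum (fun x => Re (g x))).
  rewrite -E3//.
  rewrite /v; congr rsum; apply/funext => x.
  by case: (f x) (g x) => ? ? [? ?] /=; ring.
by apply/eqP; rewrite eq_complex /=; apply/andP; split; apply/eqP; ring.
Qed.

(** The 2 comes from estimating real and imaginary parts separately, each by the modulus; the powers
    of 2 in the later norm bounds descend from here. *)
Lemma cabs_csum f : is_l1 f -> cabs (csum f) <= 2 * l1norm f.
Proof.
move=> sf; apply: le_trans (cabs_ReIm _) _; rewrite /= mulr_natl mulr2n.
apply: lerD.
  apply: le_trans (rsum_norm (is_l1_Re sf)) _.
  by apply: ler_sum_ge0 => // x; exact: ler_abs_Re.
apply: le_trans (rsum_norm (is_l1_Im sf)) _.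
by apply: ler_sum_ge0 => // x; exact: ler_abs_Im.
Qed.

Definition delta (g : G) : G -> C := fun x => if x == g then 1 else 0.

Lemma cabs_delta (g : G) :
  (fun x => cabs (delta g x)) = fun x => if x == g then 1 else 0.
Proof.
by apply/funext => x; rewrite /delta; case: ifP; rewrite ?cabs1 ?cabs0.
Qed.

Lemma is_l1_delta (g : G) : is_l1 (delta g).
Proof. by rewrite is_l1E cabs_delta; case: (sum_ge0_single g (@ler01 R)). Qed.

Lemma l1norm_delta (g : G) : l1norm (delta g) = 1.
Proof. by rewrite l1normE cabs_delta; case: (sum_ge0_single g (@ler01 R)). Qed.

Lemma csum_deltaM (g : G) u : csum (fun x => delta g x * u x) = u g.
Proof.
rewrite /csum; apply/eqP; rewrite eq_complex /=; apply/andP; split; apply/eqP.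
- rewrite -(rsum_single g (Re (u g))); congr rsum; apply/funext => x.
  by rewrite /delta; case: eqP => [->|_]; rewrite ?mul1r ?mul0r.
- rewrite -(rsum_single g (Im (u g))); congr rsum; apply/funext => x.
  by rewrite /delta; case: eqP => [->|_]; rewrite ?mul1r ?mul0r.
Qed.

Lemma csum_delta (g : G) : csum (delta g) = 1.
Proof.
rewrite -[RHS](csum_deltaM g (fun=> 1)).
by congr csum; apply/funext => x; rewrite mulr1.
Qed.

Lemma is_l1_mulr a u (K : R) : is_l1 a -> (forall x, cabs (u x) <= K) ->
  is_l1 (fun x => a x * u x).
Proof.
move=> sa uK; apply: is_l1_le (rsummableZ K sa) => x.
by rewrite cabsM mulrC ler_wpM2r ?cabs_ge0.
Qed.

Lemma cabs_csum_mulr a u (K : R) : is_l1 a -> (forall x, cabs (u x) <= K) ->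
  cabs (csum (fun x => a x * u x)) <= 2 * K * l1norm a.
Proof.
move=> sa uK; apply: le_trans (cabs_csum (is_l1_mulr sa uK)) _.
rewrite -mulrA ler_pM2l//.
have K0 : 0 <= K by apply: le_trans (uK (gone G)); exact: cabs_ge0.
rewrite l1normE -sum_ge0Z//; last by move=> x; exact: cabs_ge0.
apply: l1norm_le; last exact: rsummableZ.
by move=> x; rewrite cabsM mulrC ler_wpM2r ?cabs_ge0.
Qed.

(** Finitely supported functions are dense in l^1(G), and a bounded linear map that kills point
    masses kills them all. Identities between bounded multilinear maps are reduced to group elements
    through this lemma. *)
Lemma l1_delta_ind (L : (G -> C) -> C) (K : R) :
  (forall f g c, is_l1 f -> is_l1 g ->
     L (fadd f (fscale c g)) = L f + c * L g) ->
  (forall f, is_l1 f -> cabs (L f) <= K * l1norm f) ->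
  (forall y : G, L (delta y) = 0) -> forall f, is_l1 f -> L f = 0.
Proof.
move=> LD LK Ld.
have l10 : is_l1 ((fun=> 0) : G -> C).
  by apply: is_l1_le (is_l1_delta (gone G)) => x; rewrite cabs0 cabs_ge0.
have L0 : L (fun=> 0) = 0.
  have {1}-> : (fun=> 0) = fadd (fun=> 0) (fscale (-1) (fun=> 0)) :> (G -> C).
    by apply/funext => x; rewrite /fadd /fscale mulr0 addr0.
  by rewrite LD// mulN1r subrr.
have Lfin (s : seq G) f :
    is_l1 f -> (forall x, x \notin s -> f x = 0) -> L f = 0.
  elim: s f => [|y s IH] f sf f0.
    by rewrite (_ : f = fun=> 0)//; apply/funext => x; exact: f0.
  pose g x := if x == y then 0 else f x.
  have sg : is_l1 g.
    apply: is_l1_le sf => x; rewrite /g; case: ifP => // _.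
    by rewrite cabs0 cabs_ge0.
  have -> : f = fadd g (fscale (f y) (delta y)).
    apply/funext => x; rewrite /fadd /fscale /g /delta.
    by case: eqP => [->|_]; rewrite ?mulr1 ?mulr0 ?add0r ?addr0.
  rewrite LD//; last exact: is_l1_delta.
  rewrite Ld mulr0 addr0 IH// => x xs; rewrite /g; case: eqP => // /eqP xy.
  by apply: f0; rewrite inE negb_or xy.
move=> f sf; apply: Normc.eq0_normc; apply/eqP; rewrite eq_le cabs_ge0 andbT.
apply/ler_addgt0Pl => e e0; rewrite addr0.
(* The absolute value covers a K of unknown sign, and the [+ 1] keeps the denominator positive when
   K = 0. *)
have e'0 : 0 < e / (`|K| + 1) by rewrite divr_gt0// ltr_wpDl.
have [s se] := sum_ge0_tail (fun x => cabs_ge0 (f x)) sf e'0.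
pose g x := if x \in s then f x else 0.
pose h x := if x \in s then 0 else f x.
have sg : is_l1 g.
  apply: is_l1_le sf => x; rewrite /g; case: ifP => // _.
  by rewrite cabs0 cabs_ge0.
have sh : is_l1 h.
  apply: is_l1_le sf => x; rewrite /h; case: ifP => // _.
  by rewrite cabs0 cabs_ge0.
have -> : f = fadd g (fscale 1 h).
  apply/funext => x; rewrite /fadd /fscale /g /h mul1r.
  by case: ifP; rewrite ?add0r ?addr0.
rewrite LD// mul1r (Lfin s)// ?add0r; last first.
  by move=> x; rewrite /g => /negbTE ->.
have hE : l1norm h <= e / (`|K| + 1).
  apply: le_trans se; rewrite l1normE le_eqVlt; apply/orP; left; apply/eqP.
  by congr sum_ge0; apply/funext => x; rewrite /h; case: ifP; rewrite ?cabs0.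
apply: le_trans (LK _ sh) _.
apply: (@le_trans _ _ ((`|K| + 1) * l1norm h)).
  by rewrite ler_wpM2r ?l1norm_ge0// (le_trans (ler_norm _))// lerDl.
by rewrite -ler_pdivlMl ?ltr_wpDl// mulrC.
Qed.

Lemma is_l1_conv_term f g (x : G) : is_l1 f -> is_l1 g ->
  is_l1 (fun y => f y * g (gmul (ginv y) x)).
Proof.
move=> sf sg.
have [s _ _] := sum_ge0_conv
  (fun x => cabs_ge0 (f x)) (fun x => cabs_ge0 (g x)) sf sg.
by apply: is_l1_le (s x) => y; rewrite cabsM.
Qed.

Lemma is_l1_conv f g : is_l1 f -> is_l1 g -> is_l1 (conv f g).
Proof.
move=> sf sg.
have [s1 s2 _] := sum_ge0_conv
  (fun x => cabs_ge0 (f x)) (fun x => cabs_ge0 (g x)) sf sg.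
apply: is_l1_le (rsummableZ 2 s2) => x.
apply: le_trans (cabs_csum (is_l1_conv_term x sf sg)) _.
by rewrite ler_pM2l//; apply: l1norm_le => // y; rewrite cabsM.
Qed.

Lemma l1norm_conv f g : is_l1 f -> is_l1 g ->
  l1norm (conv f g) <= 2 * (l1norm f * l1norm g).
Proof.
move=> sf sg.
have [s1 s2 le] := sum_ge0_conv
  (fun x => cabs_ge0 (f x)) (fun x => cabs_ge0 (g x)) sf sg.
apply: (@le_trans _ _ (2 * sum_ge0 (fun x =>
  sum_ge0 (fun y => cabs (f y) * cabs (g (gmul (ginv y) x)))))); last first.
  by rewrite ler_pM2l.
rewrite -sum_ge0Z//; last first.
  by move=> x; apply: sum_ge0_ge0 => y; rewrite mulr_ge0 ?cabs_ge0.
apply: l1norm_le; last exact: rsummableZ.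
move=> x; apply: le_trans (cabs_csum (is_l1_conv_term x sf sg)) _.
by rewrite ler_pM2l//; apply: l1norm_le => // y; rewrite cabsM.
Qed.

Lemma convDl f g a c : is_l1 f -> is_l1 g -> is_l1 a ->
  conv (fadd f (fscale c g)) a = fadd (conv f a) (fscale c (conv g a)).
Proof.
move=> sf sg sa; apply/funext => x; rewrite /fadd /fscale /conv.
rewrite -csumD; try exact: is_l1_conv_term.
by congr csum; apply/funext => y; ring.
Qed.

Lemma convDr f g a c : is_l1 f -> is_l1 g -> is_l1 a ->
  conv a (fadd f (fscale c g)) = fadd (conv a f) (fscale c (conv a g)).
Proof.
move=> sf sg sa; apply/funext => x; rewrite /fadd /fscale /conv.
rewrite -csumD; try exact: is_l1_conv_term.
by congr csum; apply/funext => y; ring.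
Qed.

Lemma conv_delta (g h : G) : conv (delta g) (delta h) = delta (gmul g h).
Proof.
apply/funext => x; rewrite /conv csum_deltaM /delta.
have -> : (gmul (ginv g) x == h) = (x == gmul g h); last by [].
by apply/eqP/eqP => [<-|->]; rewrite ?gmulVKg ?gmulKg.
Qed.

Lemma augm_translate f (y : G) : csum (fun x => f (gmul (ginv y) x)) = csum f.
Proof.
have E (q : G -> R) : rsum (fun x => q (gmul (ginv y) x)) = rsum q.
  rewrite !rsumE; congr (_ - _); rewrite /sum_ge0; congr fine.
  - exact: (esum_translate (fun x => Num.max (q x) 0)).
  - exact: (esum_translate (fun x => Num.max (- q x) 0)).
by rewrite /csum (E (fun x => Re (f x))) (E (fun x => Im (f x))).
Qed.

Lemma augmD f g c : is_l1 f -> is_l1 g ->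
  augm (fadd f (fscale c g)) = augm f + c * augm g.
Proof. by move=> sf sg; rewrite /augm -csumD. Qed.

(** For fixed g the defect of multiplicativity is a bounded linear functional of f. At a point mass
    it vanishes, because the convolution is then a translate of g. *)
Lemma augm_conv f g : is_l1 f -> is_l1 g -> augm (conv f g) = augm f * augm g.
Proof.
move=> sf sg; apply/eqP; rewrite -subr_eq0; apply/eqP; move: f sf.
(* 4 = 2 * 2: one factor from [cabs_csum], the other from [l1norm_conv]. *)
apply: (@l1_delta_ind _ (4 * l1norm g + 2 * cabs (augm g))).
- move=> f h c sf sh; rewrite convDl// !augmD//; try exact: is_l1_conv.
  by ring.
- move=> f sf; rewrite (le_trans (cabsD _ _))// cabsN cabsM mulrDl.
  apply: lerD.
    rewrite (le_trans (cabs_csum (is_l1_conv sf sg)))//.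
    by have := l1norm_conv sf sg; lra.
  have := cabs_csum sf; rewrite -/(augm f) => le1.
  by have := ler_wpM2r (cabs_ge0 (augm g)) le1; lra.
move=> y; rewrite /augm csum_delta mul1r.
apply/eqP; rewrite subr_eq0; apply/eqP.
rewrite -[RHS](augm_translate g y); congr csum; apply/funext => x.
by rewrite /conv csum_deltaM.
Qed.

Lemma in_I0_conv_l f a : in_I0 f -> is_l1 a -> in_I0 (conv f a).
Proof.
by move=> [sf f0] sa; split; [exact: is_l1_conv|rewrite augm_conv// f0 mul0r].
Qed.

Lemma in_I0_conv_r f a : in_I0 f -> is_l1 a -> in_I0 (conv a f).
Proof.
by move=> [sf f0] sa; split; [exact: is_l1_conv|rewrite augm_conv// f0 mulr0].
Qed.

Definition delta_diff (x y : G) : G -> C :=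
  fadd (delta x) (fscale (-1) (delta y)).

Lemma delta_diffE (x y z : G) : delta_diff x y z = delta x z - delta y z.
Proof. by rewrite /delta_diff /fadd /fscale mulN1r. Qed.

Lemma in_I0_delta_diff x y : in_I0 (delta_diff x y).
Proof.
split; first by apply: is_l1D; exact: is_l1_delta.
by rewrite augmD ?/augm ?csum_delta ?mulr1 ?subrr//; exact: is_l1_delta.
Qed.

Lemma l1norm_delta_diff x y : l1norm (delta_diff x y) <= 2.
Proof.
apply: le_trans (l1normD _ (is_l1_delta x) (is_l1_delta y)) _.
by rewrite cabsN cabs1 !l1norm_delta; lra.
Qed.

Lemma conv_delta_diff_l (x y g : G) :
  conv (delta_diff x y) (delta g) = delta_diff (gmul x g) (gmul y g).
Proof. by rewrite convDl ?conv_delta//; exact: is_l1_delta. Qed.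

Lemma conv_delta_diff_r (x y g : G) :
  conv (delta g) (delta_diff x y) = delta_diff (gmul g x) (gmul g y).
Proof. by rewrite convDr ?conv_delta//; exact: is_l1_delta. Qed.

(** [P] projects l^1(G) onto I_0(G) along the point mass at the identity, so phi composed with [P]
    is a bounded functional on all of l^1(G), within reach of [l1_delta_ind]. Its bound has a factor
    3: 1 for g and 2 for the augmentation of g. *)
Lemma dualI0_delta_ind (phi : functional R G) : is_dualI0 phi ->
  (forall x, phi (delta_diff x (gone G)) = 0) -> forall f, in_I0 f -> phi f = 0.
Proof.
move=> [phiD [K phiK]] phi0 f [sf f0].
pose e := delta (gone G).
have se : is_l1 e by exact: is_l1_delta.
pose P g : G -> C := fadd g (fscale (- augm g) e).
have PI g : is_l1 g -> in_I0 (P g).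
  move=> sg; split; first exact: is_l1D.
  by rewrite augmD// [augm e]csum_delta mulr1 addrN.
have -> : f = P f.
  by apply/funext => x; rewrite /P f0 /fadd /fscale oppr0 mul0r addr0.
apply: (@l1_delta_ind (fun g => phi (P g)) (`|K| * 3)) sf.
- move=> g h c sg sh; rewrite -phiD//; try exact: PI.
  congr phi; apply/funext => x; rewrite /P augmD// /fadd /fscale; ring.
- move=> g sg; apply: le_trans (phiK _ (PI _ sg)) _.
  apply: (@le_trans _ _ (`|K| * l1norm (P g))).
    by rewrite ler_wpM2r ?l1norm_ge0// ler_norm.
  rewrite -mulrA ler_wpM2l// (le_trans (l1normD _ sg se))//.
  by rewrite cabsN l1norm_delta; have := cabs_csum sg; rewrite -/(augm g); lra.
by move=> g; rewrite /P [augm _]csum_delta; exact: phi0.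
Qed.

End L1Theory.

(** * Invariant means *)

Section InvariantMean.
Variables (R : realType) (X : Type) (I : eqType) (phi : I -> X -> X).
Hypothesis phiC : forall i j x, phi i (phi j x) = phi j (phi i x).
Implicit Types (f g : X -> R) (s : seq I) (n : nat).

Definition bounded_by (K : R) f := forall x, `|f x| <= K.

Definition average n i f : X -> R :=
  fun x => n.+1%:R^-1 * \sum_(k < n.+1) f (iter k (phi i) x).

Definition averages n s f : X -> R := foldr (average n) f s.

Lemma averageC n i j f :
  average n i (average n j f) = average n j (average n i f).
Proof.
have C1 (k : nat) x : iter k (phi i) (phi j x) = phi j (iter k (phi i) x).
  by elim: k => //= k ->; rewrite phiC.
have C2 (l k : nat) x :
    iter k (phi i) (iter l (phi j) x) = iter l (phi j) (iter k (phi i) x).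
  by elim: l => //= l <-; rewrite C1.
apply/funext => x; rewrite /average; congr (_ * _).
rewrite -!mulr_sumr exchange_big; congr (_ * _) => /=.
by apply: eq_bigr => l _; apply: eq_bigr => k _; rewrite C2.
Qed.

Lemma averageB n i f g :
  average n i (fun x => f x - g x) = fun x => average n i f x - average n i g x.
Proof. by apply/funext => x; rewrite /average sumrB mulrBr. Qed.

Lemma average_cst n i (c : R) : average n i (fun=> c) = fun=> c.
Proof.
apply/funext => x; rewrite /average sumr_const card_ord.
by rewrite -[c *+ _]mulr_natl mulKf.
Qed.

Lemma average_bounded n i K f : bounded_by K f -> bounded_by K (average n i f).
Proof.
move=> fK x; rewrite /average normrM ger0_norm ?invr_ge0//.
rewrite ler_pdivrMl ?ltr0Sn//; apply: le_trans (ler_norm_sum _ _ _) _.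
apply: le_trans (ler_sum _ (fun k _ => fK _)) _.
by rewrite sumr_const card_ord mulr_natl.
Qed.

Lemma averagesB n s f g : averages n s (fun x => f x - g x) =
  fun x => averages n s f x - averages n s g x.
Proof. by elim: s => //= i s ->; rewrite averageB. Qed.

Lemma averages_cst n s (c : R) : averages n s (fun=> c) = fun=> c.
Proof. by elim: s => //= i s ->; rewrite average_cst. Qed.

Lemma averages_bounded n s K f : bounded_by K f -> bounded_by K (averages n s f).
Proof. by move=> fK; elim: s => //= i s; exact: average_bounded. Qed.

(** Averages along commuting maps commute, so the one along [phi i] can be moved to the innermost
    place, where it meets the function directly. *)
Lemma averages_mem n s i : i \in s ->
  exists s', forall f, averages n s f = averages n s' (average n i f).
Proof.
elim: s => //= j s IH; rewrite inE => /orP[/eqP <-|/IH[s' Es]].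
  exists s => f; elim: s {IH} => //= k s IHs.
  by rewrite averageC IHs.
by exists (j :: s') => f; rewrite Es.
Qed.

(** The difference telescopes: a shift by [phi i] changes only the two end terms among n + 1, each
    bounded by K. *)
Lemma average_translate n i K f x : bounded_by K f ->
  `|average n i (f \o phi i) x - average n i f x| <= n.+1%:R^-1 * (2 * K).
Proof.
move=> fK; rewrite /average -mulrBr normrM ger0_norm ?invr_ge0//.
rewrite ler_wpM2l ?invr_ge0// -sumrB (eq_bigr (fun k : 'I_n.+1 =>
  f (iter k.+1 (phi i) x) - f (iter k (phi i) x)))//.
rewrite -(big_mkord xpredT
  (fun k => f (iter k.+1 (phi i) x) - f (iter k (phi i) x))).
rewrite telescope_sumr// (le_trans (ler_normB _ _))// mulr_natl mulr2n.
exact: lerD.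
Qed.

Lemma averages_translate n s i K f x : bounded_by K f -> i \in s ->
  `|averages n s (f \o phi i) x - averages n s f x| <= n.+1%:R^-1 * (2 * K).
Proof.
move=> fK /(averages_mem n)[s' Es]; rewrite !Es.
have -> : averages n s' (average n i (f \o phi i)) x -
    averages n s' (average n i f) x =
  averages n s' (fun x => average n i (f \o phi i) x - average n i f x) x.
  by rewrite averagesB.
by apply: averages_bounded => y; exact: average_translate.
Qed.

(** Compactness of [-K, K] gives a cluster point, and an ultrafilter converges to each of its
    cluster points. *)
Lemma ultra_cvg_bounded (D : Type) (U : set_system D) (h : D -> R) K :
  UltraFilter U -> (forall d, `|h d| <= K) -> exists l : R, h @ U --> l.
Proof.
move=> UU hK; have UP : ProperFilter U := ultra_proper.
have [l [_ cl]] : `[- K, K] `&` cluster (h @ U) !=set0.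
  apply: segment_compact; rewrite /fmap/=; apply: (filterS _ (@filterT _ U _)).
  by move=> d _ /=; rewrite in_itv/= -ler_norml; exact: hK.
exists l => V Vl; have [//|UV] := in_ultra_setVsetC (h @^-1` V) UU.
have /cl/(_ Vl)[y [/= nVy Vy]] : (h @ U) (~` V) by exact: UV.
by [].
Qed.

(** As in the Markov-Kakutani theorem, a commuting family of self-maps has an invariant mean. It is
    the limit of the averages at x0 along an ultrafilter on pairs (finite list of maps, length),
    finer than the filter of tails [B]. *)
Lemma invariant_mean (x0 : X) : exists m : (X -> R) -> R,
  [/\ (forall f g K, bounded_by K f -> bounded_by K g ->
         m (fun x => f x - g x) = m f - m g),
      (forall c, m (fun=> c) = c),
      (forall f K, bounded_by K f -> `|m f| <= K) &
      (forall f i K, bounded_by K f -> m (f \o phi i) = m f)].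
Proof.
pose B (d0 : seq I * nat) :=
  [set d : seq I * nat | {subset d0.1 <= d.1} /\ (d0.2 <= d.2)%N].
have FF : ProperFilter (filter_from setT B).
  apply: filter_from_proper; last by move=> d _; exists d; split.
  apply: filter_from_filter; first by exists ([::], 0%N).
  move=> [s n] [t k] _ _; exists (s ++ t, maxn n k) => // -[u l] /= [st].
  rewrite geq_max => /andP[nl kl]; split; split=> //= i it; apply: st;
  by rewrite mem_cat it ?orbT.
have [U [UU FU]] := ultraFilterLemma FF.
have UP : ProperFilter U := ultra_proper.
pose h f (d : seq I * nat) := averages d.2 d.1 f x0.
have h_cvg f K : bounded_by K f -> cvg (h f @ U).
  move=> fK; have [//|l hl] := @ultra_cvg_bounded _ U (h f) K UU.
    by move=> d; exact: averages_bounded.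
  by apply/cvg_ex; exists l.
exists (fun f => lim (h f @ U)); split.
- move=> f g K /h_cvg fc /h_cvg gc; apply/cvg_lim => //.
  have -> : h (fun x => f x - g x) = h f \- h g.
    by apply/funext => d; rewrite /h averagesB.
  exact: cvgB.
- move=> c; apply/cvg_lim => //.
  have -> : h (fun=> c) = fun=> c by apply/funext => d; rewrite /h averages_cst.
  exact: cvg_cst.
- move=> f K fK; have fc := h_cvg _ _ fK.
  rewrite ler_norml; apply/andP; split.
    apply: limr_ge => //; apply: nearW => d.
    by have := averages_bounded d.2 d.1 fK x0; rewrite ler_norml => /andP[].
  apply: limr_le => //; apply: nearW => d.
  by have := averages_bounded d.2 d.1 fK x0; rewrite ler_norml => /andP[].
move=> f i K fK.
have fiK : bounded_by K (f \o phi i) by move=> x; exact: fK.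
have [fc fic] := (h_cvg _ _ fK, h_cvg _ _ fiK).
apply/eqP; rewrite -subr_eq0 -limB//; apply/eqP/cvg_lim => //.
apply/cvgr0Pnorm_le => e e0.
have [N _ NP] : \forall n \near \oo, n.+1%:R^-1 < e / (`|2 * K| + 1).
  by apply: near_infty_natSinv_lt (PosNum _); rewrite divr_gt0// ltr_wpDl.
(* On this tail the list contains i and n >= N, so the translation defect, at most 2 K / (n + 1), is
   at most e. *)
apply: (FU); exists ([:: i], N) => // -[s n] /= [/(_ i) si /NP/= lt_e].
apply: le_trans (averages_translate _ _ fK _) _; first by rewrite si ?mem_seq1.
apply: (@le_trans _ _ (n.+1%:R^-1 * (`|2 * K| + 1))).
  by rewrite ler_wpM2l ?invr_ge0// (le_trans (ler_norm _))// lerDl.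
by rewrite -ler_pdivlMr ?ltr_wpDl// ltW.
Qed.

End InvariantMean.

(** * Bounded cochains *)

(** Merging two neighbours preserves an ordered product, by associativity alone. It serves both the
    product of norms in [bounded_cochain_merge] and the non-commutative product in [gprod_merge]. *)
Lemma big_merge (A : Type) (idx : A) (op : Monoid.law idx) (F : nat -> A)
    (n : nat) (i : 'I_n) :
  \big[op/idx]_(j < n) (if (j < i)%N then F j else
     if j == i :> nat then op (F j) (F j.+1) else F j.+1) =
  \big[op/idx]_(j < n.+1) F j.
Proof.
have lt_in := ltn_ord i.
rewrite -(big_mkord xpredT (fun j => if (j < i)%N then F j else
     if j == i :> nat then op (F j) (F j.+1) else F j.+1)).
rewrite -(big_mkord xpredT F).
rewrite (big_cat_nat (n := i))//= 1?ltnW//.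
rewrite [RHS](big_cat_nat (n := i))//= 1?ltnW// 1?ltnW//; congr (op _ _).
  by apply: eq_big_nat => j /= ->.
rewrite big_ltn// ltnn eqxx [RHS]big_ltn 1?ltnW// -Monoid.mulmA.
congr (op _ _); rewrite [RHS]big_ltn//; congr (op _ _).
rewrite [RHS]big_add1/=; apply: eq_big_nat => j /andP[ij _].
by rewrite ltnNge ltnW//= gtn_eqF.
Qed.

Lemma inord_lift0 n (j : 'I_n) : inord j.+1 = lift ord0 j :> 'I_n.+1.
Proof. by apply: val_inj; rewrite /= inordK// ltnS. Qed.

Lemma inord_widen n (j : 'I_n) : inord j = widen_ord (leqnSn n) j :> 'I_n.+1.
Proof. by apply: val_inj; rewrite /= inordK// ltnS ltnW. Qed.

Section Cochains.
Variables (R : realType) (G : discGroup).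
Local Notation C := R[i].
Implicit Types (f g b : G -> C) (c : C).

Lemma upd_id n (a : 'I_n -> G -> C) i : upd a i (a i) = a.
Proof. by apply/funext => j; rewrite /upd; case: eqP => [->|]. Qed.

Lemma upd_eq n (a : 'I_n -> G -> C) i b : upd a i b i = b.
Proof. by rewrite /upd eqxx. Qed.

Lemma upd_neq n (a : 'I_n -> G -> C) i j b : j != i -> upd a i b j = a j.
Proof. by rewrite /upd => /negbTE ->. Qed.

Lemma all_l1_upd n (a : 'I_n -> G -> C) i b :
  all_l1 a -> is_l1 b -> all_l1 (upd a i b).
Proof. by move=> sa sb j; rewrite /upd; case: ifP. Qed.

Definition norm_bound n (T : cochain R G n) (K : R) := forall a x,
  all_l1 a -> in_I0 x ->
  cabs (T a x) <= K * (\prod_(i < n) l1norm (a i)) * l1norm x.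

Lemma prod_l1norm_ge0 n (a : 'I_n -> G -> C) : 0 <= \prod_(i < n) l1norm (a i).
Proof. by apply: prodr_ge0 => i _; exact: l1norm_ge0. Qed.

Lemma norm_boundW n (T : cochain R G n) K L :
  K <= L -> norm_bound T K -> norm_bound T L.
Proof.
move=> KL TK a x sa Ix; apply: le_trans (TK _ _ sa Ix) _.
by rewrite !ler_wpM2r ?l1norm_ge0 ?prod_l1norm_ge0.
Qed.

Lemma bounded_cochain_intro n (T : cochain R G n) K :
  (forall a f g c, all_l1 a -> in_I0 f -> in_I0 g ->
     T a (fadd f (fscale c g)) = T a f + c * T a g) ->
  (forall a i b b' c x, all_l1 a -> is_l1 b -> is_l1 b' -> in_I0 x ->
     T (upd a i (fadd b (fscale c b'))) x =
     T (upd a i b) x + c * T (upd a i b') x) ->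
  norm_bound T K -> bounded_cochain T.
Proof.
move=> T1 T2 TK; split.
- move=> a sa; split; first by move=> *; exact: T1.
  by exists (K * \prod_(i < n) l1norm (a i)) => f If; exact: TK.
- by move=> a i b b' c sa sb sb' x Ix; exact: T2.
- by exists K.
Qed.

Lemma bounded_cochain_elim n (T : cochain R G n) : bounded_cochain T ->
  [/\ (forall a f g c, all_l1 a -> in_I0 f -> in_I0 g ->
        T a (fadd f (fscale c g)) = T a f + c * T a g),
      (forall a i b b' c x, all_l1 a -> is_l1 b -> is_l1 b' -> in_I0 x ->
        T (upd a i (fadd b (fscale c b'))) x =
        T (upd a i b) x + c * T (upd a i b') x) &
      exists2 K, 0 <= K & norm_bound T K].
Proof.
move=> [T1 T2 [K TK]]; split.
- by move=> a f g c sa If Ig; have [TD _] := T1 _ sa; exact: TD.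
- by move=> a i b b' c x sa sb sb' Ix; exact: T2.
- by exists `|K| => //; apply: norm_boundW TK; exact: ler_norm.
Qed.

Lemma bounded_cochainD n (T U : cochain R G n) c :
  bounded_cochain T -> bounded_cochain U ->
  bounded_cochain (fun a x => T a x + c * U a x).
Proof.
move=> /bounded_cochain_elim[T1 T2 [K K0 TK]].
move=> /bounded_cochain_elim[U1 U2 [L L0 UL]].
apply: (@bounded_cochain_intro _ _ (K + cabs c * L)).
- by move=> a f g d sa If Ig; rewrite T1// U1//; ring.
- by move=> a i b b' d x sa sb sb' Ix; rewrite T2// U2//; ring.
- move=> a x sa Ix; rewrite (le_trans (cabsD _ _))// cabsM !mulrDl.
  apply: lerD; first exact: TK.
  by rewrite -2!mulrA ler_wpM2l ?cabs_ge0// mulrA; exact: UL.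
Qed.

Lemma bounded_cochain0 n : bounded_cochain ((fun _ _ => 0) : cochain R G n).
Proof.
apply: (@bounded_cochain_intro _ _ 0); try by move=> *; rewrite mulr0 addr0.
by move=> a x _ _; rewrite cabs0 !mul0r.
Qed.

Lemma bounded_cochain_sum n (I : Type) (s : seq I) (c : I -> C)
    (T : I -> cochain R G n) : (forall i, bounded_cochain (T i)) ->
  bounded_cochain (fun a x => \sum_(i <- s) c i * T i a x).
Proof.
move=> bT; elim: s => [|i s IH].
  rewrite (_ : (fun _ _ => _) = fun _ _ => 0); first exact: bounded_cochain0.
  by apply/funext => a; apply/funext => x; rewrite big_nil.
rewrite (_ : (fun _ _ => _) =
    fun a x => \sum_(i <- s) c i * T i a x + c i * T i a x).
  exact: bounded_cochainD.
by apply/funext => a; apply/funext => x; rewrite big_cons addrC.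
Qed.

Lemma all_l1_ctail n (a : 'I_n.+1 -> G -> C) : all_l1 a -> all_l1 (ctail a).
Proof. by move=> sa j; exact: sa. Qed.

Lemma all_l1_cinit n (a : 'I_n.+1 -> G -> C) : all_l1 a -> all_l1 (cinit a).
Proof. by move=> sa j; exact: sa. Qed.

Lemma all_l1_cmerge n (a : 'I_n.+1 -> G -> C) i :
  all_l1 a -> all_l1 (cmerge a i).
Proof.
move=> sa j; rewrite /cmerge; case: ifP => // _; case: ifP => // _.
exact: is_l1_conv.
Qed.

(** Entry [ord0] acts on the module variable, so linearity in it comes from linearity of S in x; the
    other entries are those of S shifted by one. The factor 2 is that of [l1norm_conv]. *)
Lemma bounded_cochain_lact n (S : cochain R G n) : bounded_cochain S ->
  bounded_cochain
    (fun (a : 'I_n.+1 -> G -> C) x => lact (a ord0) (S (ctail a)) x).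
Proof.
move=> /bounded_cochain_elim[S1 S2 [K K0 SK]]; rewrite /lact.
apply: (@bounded_cochain_intro _ _ (K * 2)).
- move=> a f g c sa If Ig; have [[sf _] [sg _]] := (If, Ig).
  by rewrite convDl// S1//; do ?[exact: all_l1_ctail | exact: in_I0_conv_l].
- move=> a i b b' c x sa sb sb' Ix; have [sx _] := Ix.
  case: (unliftP ord0 i) => [j ->|->].
    have E d : ctail (upd a (lift ord0 j) d) = upd (ctail a) j d.
      apply/funext => k; rewrite /ctail /upd inord_lift0 (inj_eq (@lift_inj _ _)).
      by case: eqP => // _; rewrite inord_lift0.
    rewrite !E !upd_neq//; apply: S2 => //; first exact: all_l1_ctail.
    exact: in_I0_conv_l.
  have E d : ctail (upd a ord0 d) = ctail a.
    by apply/funext => k; rewrite /ctail upd_neq// inord_lift0.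
  rewrite !E !upd_eq convDr// S1//; do ?exact: in_I0_conv_l.
  exact: all_l1_ctail.
- move=> a x sa Ix; have [sx _] := Ix.
  have Ixa := in_I0_conv_l Ix (sa ord0).
  apply: le_trans (SK _ _ (all_l1_ctail sa) Ixa) _; rewrite big_ord_recl.
  set P := \prod_(i < n) _; set Q := \prod_(i < n) _.
  have -> : P = Q by apply: eq_bigr => j _; rewrite /ctail inord_lift0.
  have Q0 : 0 <= Q by apply: prodr_ge0 => j _; exact: l1norm_ge0.
  apply: le_trans (ler_wpM2l _ (l1norm_conv sx (sa ord0))) _.
    by rewrite mulr_ge0.
  by rewrite le_eqVlt; apply/orP; left; apply/eqP; ring.
Qed.

Lemma bounded_cochain_ract n (S : cochain R G n) : bounded_cochain S ->
  bounded_cochain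
    (fun (a : 'I_n.+1 -> G -> C) x => ract (S (cinit a)) (a ord_max) x).
Proof.
move=> /bounded_cochain_elim[S1 S2 [K K0 SK]]; rewrite /ract.
have widen_max (j : 'I_n) : widen_ord (leqnSn n) j != ord_max.
  by rewrite -val_eqE /= ltn_eqF.
apply: (@bounded_cochain_intro _ _ (K * 2)).
- move=> a f g c sa If Ig; have [[sf _] [sg _]] := (If, Ig).
  by rewrite convDr// S1//; do ?[exact: all_l1_cinit | exact: in_I0_conv_r].
- move=> a i b b' c x sa sb sb' Ix; have [sx _] := Ix.
  have [->|i_max] := eqVneq i ord_max.
    have E d : cinit (upd a ord_max d) = cinit a.
      by apply/funext => k; rewrite /cinit inord_widen upd_neq.
    rewrite !E !upd_eq convDl// S1//; do ?exact: in_I0_conv_r.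
    exact: all_l1_cinit.
  have lt_in : (i < n)%N.
    by rewrite ltn_neqAle -ltnS ltn_ord andbT; move: i_max; rewrite -val_eqE.
  have Ei : i = widen_ord (leqnSn n) (Ordinal lt_in) by exact: val_inj.
  have E d : cinit (upd a i d) = upd (cinit a) (Ordinal lt_in) d.
    apply/funext => k; rewrite /cinit /upd inord_widen {1}Ei.
    have -> : (widen_ord (leqnSn n) k == widen_ord (leqnSn n) (Ordinal lt_in))
      = (k == Ordinal lt_in) by [].
    by case: eqP => // _; rewrite inord_widen.
  rewrite !E !upd_neq 1?eq_sym//; apply: S2 => //; first exact: all_l1_cinit.
  exact: in_I0_conv_r.
- move=> a x sa Ix; have [sx _] := Ix.
  have Ixa := in_I0_conv_r Ix (sa ord_max).
  apply: le_trans (SK _ _ (all_l1_cinit sa) Ixa) _; rewrite big_ord_recr /=.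
  set P := \prod_(i < n) _; set Q := \prod_(i < n) _.
  have -> : P = Q by apply: eq_bigr => j _; rewrite /cinit inord_widen.
  have Q0 : 0 <= Q by apply: prodr_ge0 => j _; exact: l1norm_ge0.
  apply: le_trans (ler_wpM2l _ (l1norm_conv (sa ord_max) sx)) _.
    by rewrite mulr_ge0.
  by rewrite le_eqVlt; apply/orP; left; apply/eqP; ring.
Qed.

(* F is the identity, or convolution with the entry that is merged with the
   k-th one. *)
Lemma cmerge_upd n (a : 'I_n.+1 -> G -> C) (i : 'I_n) (k : 'I_n.+1) :
  all_l1 a -> exists j : 'I_n, exists F : (G -> C) -> (G -> C),
  [/\ forall b, is_l1 b -> is_l1 (F b),
      forall b b' c, is_l1 b -> is_l1 b' ->
        F (fadd b (fscale c b')) = fadd (F b) (fscale c (F b')) &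
      forall b, cmerge (upd a k b) i = upd (cmerge a i) j (F b)].
Proof.
move=> sa.
have updE (b : G -> C) (l : nat) : (l < n.+1)%N ->
    upd a k b (inord l) = if l == k then b else a (inord l).
  by move=> ln; rewrite /upd -val_eqE /= inordK.
have E (b : G -> C) (j : 'I_n) : cmerge (upd a k b) i j =
    if (j < i)%N then (if j == k :> nat then b else a (inord j))
    else if j == i :> nat then conv (if j == k :> nat then b else a (inord j))
                            (if j.+1 == k :> nat then b else a (inord j.+1))
    else (if j.+1 == k :> nat then b else a (inord j.+1)).
  have ltj : (j < n.+1)%N by rewrite ltnS ltnW.
  by rewrite /cmerge !updE// ltnS.
have [lt_ki|gt_ki|eq_ki] := ltngtP k i.
- have lt_kn := ltn_trans lt_ki (ltn_ord i).
  exists (Ordinal lt_kn), id; split=> // b; apply/funext => j; rewrite E /upd.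
  rewrite -val_eqE /= /cmerge; case: (ltngtP j i) => ji.
  + by case: eqP.
  + by rewrite !gtn_eqF//; apply: ltn_trans lt_ki _ => //; exact: ltnW.
  + by rewrite !gtn_eqF// ji// ltnW.
- have [eq_kSi|ne_kSi] := eqVneq (k : nat) i.+1.
    exists i, (conv (a (inord i))); split.
    + by move=> b sb; exact: is_l1_conv.
    + by move=> b b' c sb sb'; exact: convDr.
    move=> b; apply/funext => j; rewrite E /upd -val_eqE /cmerge eq_kSi.
    case: (ltngtP j i) => ji.
    + by rewrite ltn_eqF// ltnW.
    + by rewrite eqSS gtn_eqF.
    + by rewrite ji eqxx ltn_eqF.
  have k0 : (0 < k)%N by exact: leq_ltn_trans gt_ki.
  have lt_kn : (k.-1 < n)%N by rewrite -ltnS prednK// ltn_ord.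
  have lt_Sik : (i.+1 < k)%N by rewrite ltn_neqAle eq_sym ne_kSi.
  exists (Ordinal lt_kn), id; split=> // b; apply/funext => j; rewrite E /upd.
  have -> : (j == Ordinal lt_kn) = (j.+1 == k).
    by rewrite -val_eqE /= -eqSS prednK.
  rewrite /cmerge; case: (ltngtP j i) => ji.
  + by rewrite !ltn_eqF// ?(ltn_trans ji)// (leq_ltn_trans ji).
  + by case: eqP.
  + by rewrite !ltn_eqF// ji// ltnW.
exists i, (fun b => conv b (a (inord i.+1))); split.
+ by move=> b sb; exact: is_l1_conv.
+ by move=> b b' c sb sb'; exact: convDl.
move=> b; apply/funext => j; rewrite E /upd -val_eqE /cmerge eq_ki.
case: (ltngtP j i) => ji.
+ by [].
+ by rewrite gtn_eqF// ltnW.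
+ by rewrite ji gtn_eqF.
Qed.

Lemma bounded_cochain_merge n (S : cochain R G n) (i : 'I_n) :
  bounded_cochain S ->
  bounded_cochain (fun (a : 'I_n.+1 -> G -> C) x => S (cmerge a i) x).
Proof.
move=> /bounded_cochain_elim[S1 S2 [K K0 SK]].
(* A factor 2 is granted to every slot, though a single slot holds a convolution: the two products
   can then be compared slot by slot. *)
apply: (@bounded_cochain_intro _ _ (K * 2 ^+ n)).
- by move=> a f g c sa If Ig; rewrite S1//; exact: all_l1_cmerge.
- move=> a k b b' c x sa sb sb' Ix.
  have [j [F [F1 F2 F3]]] := cmerge_upd i k sa.
  have sm := all_l1_cmerge i sa; have [Fb Fb'] := (F1 _ sb, F1 _ sb').
  by rewrite !F3 F2// S2.
- move=> a x sa Ix; apply: le_trans (SK _ _ (all_l1_cmerge i sa) Ix) _.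
  rewrite ler_wpM2r ?l1norm_ge0// -mulrA ler_wpM2l//.
  pose F k := l1norm (a (inord k)).
  have -> : \prod_(j < n.+1) l1norm (a j) = \prod_(j < n.+1) F j.
    by apply: eq_bigr => j _; rewrite /F inord_val.
  rewrite -(big_merge _ F i) /= -[in 2 ^+ n](card_ord n) -prodr_const.
  rewrite -big_split /=.
  apply: ler_prod => j _; rewrite l1norm_ge0 /= /cmerge /F.
  have le2 (t : R) : 0 <= t -> t <= 2 * t by move=> ?; lra.
  case: ifP => _; first by rewrite le2 ?l1norm_ge0.
  case: ifP => _; last by rewrite le2 ?l1norm_ge0.
  exact: l1norm_conv.
Qed.

Lemma bounded_cochain_coboundary n (S : cochain R G n) :
  bounded_cochain S -> bounded_cochain (coboundary S).
Proof.
move=> bS; rewrite (_ : coboundary S = fun a x =>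
    (lact (a ord0) (S (ctail a)) x
     + 1 * \sum_(i <- enum 'I_n) (-1) ^+ i.+1 * S (cmerge a i) x)
    + (-1) ^+ n.+1 * ract (S (cinit a)) (a ord_max) x); last first.
  by apply/funext => a; apply/funext => x; rewrite mul1r big_enum.
apply: bounded_cochainD; last exact: bounded_cochain_ract.
apply: bounded_cochainD; first exact: bounded_cochain_lact.
apply: (@bounded_cochain_sum n.+1 _ _ (fun i : 'I_n => (-1) ^+ i.+1)
  (fun i a x => S (cmerge a i) x)) => i.
exact: bounded_cochain_merge.
Qed.

Lemma bounded_cochain_delta_ind n (T : cochain R G n) : bounded_cochain T ->
  (forall (s : 'I_n -> G) (y : G),
     T (fun i => delta R (s i)) (delta_diff R y (gone G)) = 0) ->
  forall a x, all_l1 a -> in_I0 x -> T a x = 0.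
Proof.
move=> bT T0; have [T1 T2 [K K0 TK]] := bounded_cochain_elim bT.
(* The first k slots are arbitrary and the others hold point masses. For k = 0 only the module
   variable is left, which is [dualI0_delta_ind]; the inductive step frees slot k by
   [l1_delta_ind]. *)
suff H k : forall a, all_l1 a ->
    (forall i : 'I_n, (k <= i)%N -> exists y : G, a i = delta R y) ->
    forall x, in_I0 x -> T a x = 0.
  by move=> a x sa Ix; apply: (H n) => // i; rewrite leqNgt ltn_ord.
elim: k => [|k IH] a sa a_delta x Ix.
  have /choice[s Es] i : exists y : G, a i = delta R y by exact: a_delta.
  have -> : a = fun i => delta R (s i) by exact/funext.
  have [bT1 _ _] := bT; apply: dualI0_delta_ind Ix => //.
  by apply: bT1 => i; exact: is_l1_delta.
have [lt_kn|le_nk] := ltnP k n; last first.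
  by apply: IH => // i /(leq_trans le_nk); rewrite leqNgt ltn_ord.
pose i := Ordinal lt_kn; rewrite -(upd_id a i).
apply: (@l1_delta_ind _ _ (fun b => T (upd a i b) x)
  (K * (\prod_(j < n | j != i) l1norm (a j)) * l1norm x)) (sa i).
- by move=> f g c sf sg; exact: T2.
- move=> f sf; apply: le_trans (TK _ _ (all_l1_upd i sa sf) Ix) _.
  rewrite (bigD1 i)//= upd_eq (eq_bigr (fun j => l1norm (a j))); last first.
    by move=> j ji; rewrite upd_neq.
  by rewrite le_eqVlt; apply/orP; left; apply/eqP; ring.
move=> y; apply: IH => //; first by apply: all_l1_upd => //; exact: is_l1_delta.
move=> j; rewrite leq_eqVlt => /orP[/eqP kj|kj].
  by exists y; rewrite (_ : j = i) ?upd_eq//; apply: val_inj.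
have ji : j != i by rewrite -val_eqE /= gtn_eqF.
by rewrite upd_neq//; exact: a_delta.
Qed.

End Cochains.

(** * Multilinear extension and equivariant means *)

Section MultilinearExtension.
Variables (R : realType) (G : discGroup).
Local Notation C := R[i].

Definition gcons (A : Type) n (y : A) (t : 'I_n -> A) : 'I_n.+1 -> A :=
  fun i => if unlift ord0 i is Some j then t j else y.

Lemma gcons_ord0 (A : Type) n (y : A) (t : 'I_n -> A) : gcons y t ord0 = y.
Proof. by rewrite /gcons unlift_none. Qed.

Lemma gcons_lift (A : Type) n (y : A) (t : 'I_n -> A) j :
  gcons y t (lift ord0 j) = t j.
Proof. by rewrite /gcons liftK. Qed.

(** Summing one variable at a time keeps every sum over G itself, so bounds and linearity pass by
    induction on n. In degree 0 the constant tuple stands for the empty one, all functions on ['I_0]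
    being equal. *)
Fixpoint extend n : (('I_n -> G) -> G -> C) -> cochain R G n :=
  match n with
  | 0 => fun s a x => csum (fun h => x h * s (fun=> gone G) h)
  | n'.+1 => fun s a x => csum (fun y =>
      a ord0 y * extend (fun t => s (gcons y t)) (fun j => a (lift ord0 j)) x)
  end.

(** Each of the n + 1 iterated sums, one per entry and one for x, costs a factor 2 by
    [cabs_csum_mulr]. *)
Lemma extend_bound n (s : ('I_n -> G) -> G -> C) (B : R)
    (a : 'I_n -> G -> C) x :
  (forall t h, cabs (s t h) <= B) -> all_l1 a -> is_l1 x ->
  cabs (extend s a x) <=
  2 ^+ n.+1 * B * (\prod_(i < n) l1norm (a i)) * l1norm x.
Proof.
elim: n s a => [|n IH] s a sB sa sx /=.
  by rewrite big_ord0 mulr1 expr1; exact: cabs_csum_mulr.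
have sa1 : all_l1 (fun j => a (lift ord0 j)) by move=> j; exact: sa.
apply: le_trans (cabs_csum_mulr (sa ord0)
  (fun y => IH _ _ (fun t h => sB (gcons y t) h) sa1 sx)) _.
rewrite big_ord_recl [2 ^+ n.+2]exprS le_eqVlt.
by apply/orP; left; apply/eqP; ring.
Qed.

Lemma extendDr n (s : ('I_n -> G) -> G -> C) (B : R) (a : 'I_n -> G -> C) x y c :
  (forall t h, cabs (s t h) <= B) -> all_l1 a -> is_l1 x -> is_l1 y ->
  extend s a (fadd x (fscale c y)) = extend s a x + c * extend s a y.
Proof.
elim: n s a => [|n IH] s a sB sa sx sy /=.
  rewrite -csumD; do ?exact: is_l1_mulr (sB _).
  by congr csum; apply/funext => h; rewrite /fadd /fscale; ring.
have sa1 : all_l1 (fun j => a (lift ord0 j)) by move=> j; exact: sa.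
have sB1 z t h : cabs (s (gcons z t) h) <= B by exact: sB.
rewrite -csumD; last 2 first.
- exact: is_l1_mulr (sa _) (fun z => extend_bound (sB1 z) sa1 sx).
- exact: is_l1_mulr (sa _) (fun z => extend_bound (sB1 z) sa1 sy).
by congr csum; apply/funext => z; rewrite IH//; ring.
Qed.

Lemma extend_updD n (s : ('I_n -> G) -> G -> C) (B : R) (a : 'I_n -> G -> C) i
    (b b' : G -> C) c x :
  (forall t h, cabs (s t h) <= B) -> all_l1 a -> is_l1 b -> is_l1 b' -> is_l1 x ->
  extend s (upd a i (fadd b (fscale c b'))) x =
  extend s (upd a i b) x + c * extend s (upd a i b') x.
Proof.
elim: n s a i => [|n IH] s a i sB sa sb sb' sx /=; first by case: i.
have sB1 z t h : cabs (s (gcons z t) h) <= B by exact: sB.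
have sa1 : all_l1 (fun j => a (lift ord0 j)) by move=> j; exact: sa.
case: (unliftP ord0 i) => [j ->|->].
  have E d : (fun k => upd a (lift ord0 j) d (lift ord0 k)) =
      upd (fun k => a (lift ord0 k)) j d.
    by apply/funext => k; rewrite /upd (inj_eq (@lift_inj _ _)).
  have bnd d : is_l1 d -> is_l1 (fun y => a ord0 y *
      extend (fun t => s (gcons y t)) (upd (fun k => a (lift ord0 k)) j d) x).
    move=> sd; have sa2 := all_l1_upd j sa1 sd.
    exact: is_l1_mulr (sa _) (fun z => extend_bound (sB1 z) sa2 sx).
  rewrite !E !upd_neq// -csumD; do ?exact: bnd.
  by congr csum; apply/funext => z; rewrite IH//; ring.
have E d : (fun k => upd a ord0 d (lift ord0 k)) = fun k => a (lift ord0 k).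
  by apply/funext => k; rewrite upd_neq.
rewrite !E !upd_eq -csumD; last 2 first.
- exact: is_l1_mulr sb (fun z => extend_bound (sB1 z) sa1 sx).
- exact: is_l1_mulr sb' (fun z => extend_bound (sB1 z) sa1 sx).
by congr csum; apply/funext => z; rewrite /fadd /fscale; ring.
Qed.

Lemma bounded_cochain_extend n (s : ('I_n -> G) -> G -> C) (B : R) :
  (forall t h, cabs (s t h) <= B) -> bounded_cochain (extend s).
Proof.
move=> sB; apply: (@bounded_cochain_intro _ _ _ _ (2 ^+ n.+1 * B)).
- by move=> a f g c sa [sf _] [sg _]; exact: extendDr sB _ _ _.
- by move=> a i b b' c x sa sb sb' [sx _]; exact: extend_updD sB _ _ _ _.
- by move=> a x sa [sx _]; exact: extend_bound.
Qed.

Lemma extend_delta n (s : ('I_n -> G) -> G -> C) (t : 'I_n -> G) x :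
  extend s (fun i => delta R (t i)) x = csum (fun h => x h * s t h).
Proof.
elim: n s t => [|n IH] s t /=.
  by rewrite (_ : t = fun=> gone G)//; apply/funext => -[].
rewrite csum_deltaM IH; congr csum; apply/funext => h; congr (_ * s _ h).
apply/funext => i; case: (unliftP ord0 i) => [j ->|->].
  by rewrite gcons_lift.
by rewrite gcons_ord0.
Qed.

Lemma extend_delta_diff n (s : ('I_n -> G) -> G -> C) (t : 'I_n -> G) u v :
  extend s (fun i => delta R (t i)) (delta_diff R u v) = s t u - s t v.
Proof.
have sd (y : G) : is_l1 (fun h => delta R y h * s t h).
  apply: (@is_l1_le _ _ _ (fun h => if h == y then cabs (s t y) else 0)).
    by move=> h; rewrite /delta; case: eqP => [->|_]; rewrite ?mul1r ?mul0r ?cabs0.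
  by case: (sum_ge0_single y (cabs_ge0 (s t y))).
rewrite extend_delta -[s t u](csum_deltaM u (s t)) -[s t v](csum_deltaM v (s t)).
rewrite -mulN1r -csumD//; congr csum; apply/funext => h.
by rewrite /delta_diff /fadd /fscale; ring.
Qed.

End MultilinearExtension.

(** * Means on bounded functions, equivariant under conjugation *)

Section EquivariantMeans.
Variables (R : realType) (G : discGroup).
Local Notation C := R[i].

Definition cbounded (f : G -> C) := exists K : R, forall x, cabs (f x) <= K.

Lemma centralizer_mean : comm_transitive G -> forall r : G,
  exists m : (G -> R) -> R,
  [/\ (forall f g K, bounded_by K f -> bounded_by K g ->
         m (fun x => f x - g x) = m f - m g),
      (forall c, m (fun=> c) = c),
      (forall f K, bounded_by K f -> `|m f| <= K) &
      (forall f z K, r <> gone G -> gmul z r = gmul r z ->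
         bounded_by K f -> m (fun x => f (gmul z x)) = m f)].
Proof.
move=> Gct r.
(* Elements outside the centralizer act as the identity, so the family is indexed by G itself and
   still commutes; commutative transitivity handles two elements inside. For r = e all maps are
   trivial. *)
pose phi (z x : G) :=
  if (r != gone G) && (gmul z r == gmul r z) then gmul z x else x.
have phiC z w x : phi z (phi w x) = phi w (phi z x).
  rewrite /phi; case: eqP => //= r1; case: eqP => // zr; case: eqP => // wr.
  by rewrite !gmulA (Gct r r1 z w (esym zr) (esym wr)).
have [m [m1 m2 m3 m4]] := invariant_mean R phiC (gone G).
exists m; split=> // f z K /eqP r1 /eqP zr fK.
rewrite -[RHS](m4 f z K fK); congr m; apply/funext => x.
by rewrite /= /phi r1 zr.
Qed.

(** The mean at y is that of the representative of its conjugacy class, transported by [t y]. The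
    choice of [t] is not equivariant, but its defect lies in the centralizer of the representative,
    where invariance absorbs it. *)
Lemma equivariant_means : comm_transitive G -> exists M : G -> (G -> C) -> C,
  [/\ (forall y f g, cbounded f -> cbounded g ->
         M y (fun x => f x - g x) = M y f - M y g),
      (forall y c, M y (fun=> c) = c),
      (forall y f K, (forall x, cabs (f x) <= K) -> cabs (M y f) <= 2 * K) &
      (forall y k f, y <> gone G -> cbounded f ->
         M (conjugate k y) f = M y (fun x => f (gmul k x)))].
Proof.
move=> Gct; have /choice[m mP] := centralizer_mean Gct.
pose class (y : G) := [set z | exists k, y = conjugate k z].
pose rep y := xget (gone G) (class y).
have /choice[t tP] y : exists k, y = conjugate k (rep y).
  (* The default of [xget] is never taken, since y lies in its own class. *)
  apply: (@xgetPex _ (gone G) (class y)).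
  by exists y, (gone G); rewrite conjugate1.
have rep_conj k y : rep (conjugate k y) = rep y.
  rewrite /rep; congr (xget _ _); apply/seteqP; split=> z [l].
    move=> e; exists (gmul (ginv k) l).
    by rewrite conjugateM -e conjugateK.
  by move=> ->; exists (gmul k l); rewrite conjugateM.
have rep1 y : y <> gone G -> rep y <> gone G.
  by move=> y1 r1; apply: y1; rewrite (tP y) r1 conjugateg1.
pose re (f : G -> C) x := Re (f x).
pose im (f : G -> C) x := Im (f x).
have reK f K : (forall x, cabs (f x) <= K) -> bounded_by K (re f).
  by move=> fK x; apply: le_trans (fK x); exact: ler_abs_Re.
have imK f K : (forall x, cabs (f x) <= K) -> bounded_by K (im f).
  by move=> fK x; apply: le_trans (fK x); exact: ler_abs_Im.
exists (fun y f => Complex (m (rep y) (fun x => re f (gmul (t y) x)))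
                           (m (rep y) (fun x => im f (gmul (t y) x)))); split.
- move=> y f g [K fK] [L gL]; have [m1 _ _ _] := mP (rep y).
  have fM x : cabs (f x) <= Num.max K L by rewrite le_max fK.
  have gM x : cabs (g x) <= Num.max K L by rewrite le_max gL orbT.
  set a := m _ _; set b := m _ _.
  have -> : a = m (rep y) (fun x => re f (gmul (t y) x)) -
                m (rep y) (fun x => re g (gmul (t y) x)).
    rewrite -(m1 _ _ (Num.max K L)).
    + congr m; apply/funext => x; rewrite /re.
      by case: (f _) (g _) => ? ? [].
    + by move=> x; exact: reK.
    + by move=> x; exact: reK.
  have -> : b = m (rep y) (fun x => im f (gmul (t y) x)) -
                m (rep y) (fun x => im g (gmul (t y) x)).
    rewrite -(m1 _ _ (Num.max K L)).
    + congr m; apply/funext => x; rewrite /im.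
      by case: (f _) (g _) => ? ? [].
    + by move=> x; exact: imK.
    + by move=> x; exact: imK.
  by [].
- by move=> y [a b]; have [_ m2 _ _] := mP (rep y); rewrite /re /im /= !m2.
- move=> y f K fK; have [_ _ m3 _] := mP (rep y).
  apply: le_trans (cabs_ReIm _) _; rewrite /= mulr_natl mulr2n.
  by apply: lerD; apply: m3 => x; [exact: reK | exact: imK].
move=> y k f y1 [K fK]; have [_ _ _ m4] := mP (rep y); rewrite rep_conj.
(* Both [A] and [t (conjugate k y)] conjugate the representative to k y k^-1, so their quotient [z]
   centralizes it. *)
pose A := gmul k (t y); pose z := gmul (ginv A) (t (conjugate k y)).
have zr : gmul z (rep y) = gmul (rep y) z.
  apply: commute_conjugate; rewrite /z conjugateM.
  have -> : conjugate (t (conjugate k y)) (rep y) = conjugate k y.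
    by rewrite -(rep_conj k y) -tP.
  have -> : conjugate k y = conjugate A (rep y) by rewrite /A conjugateM -tP.
  exact: conjugateK.
have Ez : t (conjugate k y) = gmul A z by rewrite /z gmulVKg.
congr Complex; rewrite Ez.
- have -> : (fun x => re (fun x => f (gmul k x)) (gmul (t y) x)) =
      fun x => re f (gmul A x) by apply/funext => x; rewrite /re /A gmulA.
  rewrite -(m4 (fun x => re f (gmul A x)) z K (rep1 _ y1) zr); last first.
    by move=> x; exact: reK.
  by congr m; apply/funext => x; rewrite gmulA.
- have -> : (fun x => im (fun x => f (gmul k x)) (gmul (t y) x)) =
      fun x => im f (gmul A x) by apply/funext => x; rewrite /im /A gmulA.
  rewrite -(m4 (fun x => im f (gmul A x)) z K (rep1 _ y1) zr); last first.
    by move=> x; exact: imK.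
  by congr m; apply/funext => x; rewrite gmulA.
Qed.

End EquivariantMeans.

(** * The contracting homotopy *)

Section GroupTuples.
Variable G : discGroup.

(** These copy [ctail], [cinit] and [cmerge] index by index, so that a tuple of point masses is
    carried to the tuple of point masses of the result. *)
Definition gtail n (t : 'I_n.+1 -> G) : 'I_n -> G := fun j => t (inord j.+1).
Definition ginit n (t : 'I_n.+1 -> G) : 'I_n -> G := fun j => t (inord j).
Definition gmerge n (t : 'I_n.+1 -> G) (i : 'I_n) : 'I_n -> G :=
  fun j => if (j < i)%N then t (inord j)
           else if (j == i :> nat) then gmul (t (inord j)) (t (inord j.+1))
           else t (inord j.+1).
Definition gprod n (t : 'I_n -> G) : G := \big[@gmul G/gone G]_(i < n) t i.

Lemma gprod_tail n (t : 'I_n.+1 -> G) :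
  gprod t = gmul (t ord0) (gprod (gtail t)).
Proof.
rewrite /gprod big_ord_recl; congr gmul; apply: eq_bigr => j _.
by rewrite /gtail inord_lift0.
Qed.

Lemma gprod_init n (t : 'I_n.+1 -> G) :
  gprod t = gmul (gprod (ginit t)) (t ord_max).
Proof.
rewrite /gprod big_ord_recr; congr gmul; apply: eq_bigr => j _.
by rewrite /ginit inord_widen.
Qed.

Lemma gprod_merge n (t : 'I_n.+1 -> G) i : gprod (gmerge t i) = gprod t.
Proof.
rewrite /gprod /gmerge (big_merge _ (fun k => t (inord k)) i).
by apply: eq_bigr => j _; rewrite inord_val.
Qed.

Lemma gcons_inord0 n (x : G) (t : 'I_n -> G) : gcons x t (inord 0) = x.
Proof.
rewrite (_ : inord 0 = ord0) ?gcons_ord0//.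
by apply: val_inj; rewrite /= inordK.
Qed.

Lemma gcons_inordS n (x : G) (t : 'I_n.+1 -> G) k : (k < n.+1)%N ->
  gcons x t (inord k.+1) = t (inord k).
Proof.
move=> kn; rewrite (_ : inord k.+1 = lift ord0 (inord k)) ?gcons_lift//.
by apply: val_inj; rewrite /= !inordK.
Qed.

Lemma gtail_cons n (x : G) (t : 'I_n -> G) : gtail (gcons x t) = t.
Proof. by apply/funext => j; rewrite /gtail inord_lift0 gcons_lift. Qed.

Lemma ginit_cons n (x : G) (t : 'I_n.+1 -> G) :
  ginit (gcons x t) = gcons x (ginit t).
Proof.
apply/funext => j; rewrite /ginit; case: (unliftP ord0 j) => [k ->|->].
  have kn : (k < n.+1)%N by rewrite ltnS ltnW.
  by rewrite gcons_lift gcons_inordS.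
by rewrite gcons_ord0 gcons_inord0.
Qed.

Lemma gcons_max n (x : G) (t : 'I_n.+1 -> G) : gcons x t ord_max = t ord_max.
Proof.
by rewrite (_ : ord_max = lift ord0 ord_max) ?gcons_lift//; apply: val_inj.
Qed.

(** Among the merges of (x, t) only this one touches x; it yields the term that calls for
    equivariance of the means. *)
Lemma gmerge_cons0 n (x : G) (t : 'I_n.+1 -> G) :
  gmerge (gcons x t) ord0 = gcons (gmul x (t ord0)) (gtail t).
Proof.
apply/funext => j; rewrite /gmerge /=; case: (unliftP ord0 j) => [k ->|->] /=.
  by rewrite gcons_lift /bump leq0n add1n gcons_inordS// ltnS.
rewrite gcons_ord0 gcons_inord0 gcons_inordS//; congr (gmul _ (t _)).
by apply: val_inj; rewrite /= inordK.
Qed.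

Lemma gmerge_consS n (x : G) (t : 'I_n.+1 -> G) i :
  gmerge (gcons x t) (lift ord0 i) = gcons x (gmerge t i).
Proof.
apply/funext => j; rewrite /gmerge; case: (unliftP ord0 j) => [k ->|->] /=.
  have kn : (k < n.+1)%N by rewrite ltnS ltnW.
  by rewrite gcons_lift /= /bump !leq0n !add1n ltnS eqSS !gcons_inordS// ltnS.
by rewrite gcons_ord0 gcons_inord0.
Qed.

End GroupTuples.

(** * Cocycles on point masses and their averages *)

Section Homotopy.
Variables (R : realType) (G : discGroup).
Local Notation C := R[i].
Local Notation delta := (@delta R G).
Local Notation delta_diff := (@delta_diff R G).

Lemma delta_diffD (u v w : G) :
  delta_diff u v = fadd (delta_diff u w) (fscale (-1) (delta_diff v w)).
Proof. by apply/funext => x; rewrite /fadd /fscale !delta_diffE; ring. Qed.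

Lemma cmerge_delta n (t : 'I_n.+1 -> G) (i : 'I_n) :
  cmerge (fun j => delta (t j)) i = fun j => delta (gmerge t i j).
Proof.
apply/funext => j; rewrite /cmerge /gmerge; case: ifP => // _; case: ifP => // _.
exact: conv_delta.
Qed.

Section OnDeltas.
Variables (n : nat) (T : cochain R G n).
Hypothesis bT : bounded_cochain T.

Definition on_deltas (t : 'I_n -> G) (u v : G) : C :=
  T (fun i => delta (t i)) (delta_diff u v).

Let all_l1_delta (t : 'I_n -> G) : all_l1 (fun i => delta (t i)).
Proof. by move=> i; exact: is_l1_delta. Qed.

Lemma on_deltasD t u v w :
  on_deltas t u v = on_deltas t u w - on_deltas t v w.
Proof.
have [T1 _ _] := bounded_cochain_elim bT.
by rewrite /on_deltas (delta_diffD u v w) T1 ?mulN1r//; exact: in_I0_delta_diff.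
Qed.

Lemma on_deltas_self t u : on_deltas t u u = 0.
Proof. by rewrite (on_deltasD t u u u) subrr. Qed.

Lemma on_deltas_bound : exists K, forall t u v, cabs (on_deltas t u v) <= K.
Proof.
have [_ _ [K K0 TK]] := bounded_cochain_elim bT.
exists (K * 2) => t u v.
apply: le_trans (TK _ _ (all_l1_delta t) (in_I0_delta_diff R u v)) _.
rewrite big1 ?mulr1; first by rewrite ler_wpM2l ?l1norm_delta_diff.
by move=> i _; exact: l1norm_delta.
Qed.

End OnDeltas.

(** On point masses convolution is multiplication in G, and the Hochschild coboundary becomes that
    of group cohomology. *)
Lemma coboundary_deltas n (T : cochain R G n) (t : 'I_n.+1 -> G) u v :
  coboundary T (fun i => delta (t i)) (delta_diff u v) =
  on_deltas T (gtail t) (gmul u (t ord0)) (gmul v (t ord0))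
  + \sum_(i < n) (-1) ^+ i.+1 * on_deltas T (gmerge t i) u v
  + (-1) ^+ n.+1 *
    on_deltas T (ginit t) (gmul (t ord_max) u) (gmul (t ord_max) v).
Proof.
rewrite /coboundary /lact /ract conv_delta_diff_l conv_delta_diff_r.
congr (_ + _ + _); apply: eq_bigr => i _.
by rewrite cmerge_delta.
Qed.

Lemma cbounded_sum (I : Type) (s : seq I) (e : I -> nat) (F : I -> G -> C) :
  (forall i, cbounded (F i)) ->
  cbounded (fun x => \sum_(i <- s) (-1) ^+ e i * F i x).
Proof.
move=> bF; elim: s => [|i s [K sK]].
  by exists 0 => x; rewrite big_nil cabs0.
have [L FL] := bF i; exists (L + K) => x.
rewrite big_cons (le_trans (cabsD _ _))//; apply: lerD => //.
by rewrite cabs_sign.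
Qed.

Variables (M : G -> (G -> C) -> C) (n : nat) (T : cochain R G n.+1).
Hypothesis MB : forall y f g, cbounded f -> cbounded g ->
  M y (fun x => f x - g x) = M y f - M y g.
Hypothesis Mcst : forall y c, M y (fun=> c) = c.
Hypothesis Mbound : forall y f K,
  (forall x, cabs (f x) <= K) -> cabs (M y f) <= 2 * K.
Hypothesis Mconj : forall y k f, y <> gone G -> cbounded f ->
  M (conjugate k y) f = M y (fun x => f (gmul k x)).
Hypothesis bT : bounded_cochain T.
Hypothesis cocycle : forall a, all_l1 a -> deq (coboundary T a) (fun _ => 0).

Let cbounded_cst (c : C) : cbounded (fun _ : G => c).
Proof. by exists (cabs c). Qed.

(** [MB] speaks of differences only: a negative is obtained as 0 - f, a sum as f - (- g), and then
    the alternating sums of a coboundary follow. *)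
Let MN y f : cbounded f -> M y (fun x => - f x) = - M y f.
Proof.
move=> bf; rewrite -[RHS]add0r -[0 in RHS](Mcst y 0) -MB//.
by congr M; apply/funext => x; rewrite add0r.
Qed.

Let cboundedN f : cbounded f -> cbounded (fun x : G => - f x : C).
Proof. by move=> [K fK]; exists K => x; rewrite cabsN. Qed.

Let MD y f g : cbounded f -> cbounded g ->
  M y (fun x => f x + g x) = M y f + M y g.
Proof.
move=> bf bg; rewrite -[M y g]opprK -MN// -MB//; last exact: cboundedN.
by congr M; apply/funext => x; rewrite opprK.
Qed.

Let Msign y f e : cbounded f -> M y (fun x => (-1) ^+ e * f x) = (-1) ^+ e * M y f.
Proof.
move=> bf; rewrite -signr_odd; case: odd; rewrite ?expr0 ?expr1.
  by rewrite mulN1r -MN//; congr M; apply/funext => x; rewrite mulN1r.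
by rewrite mul1r; congr M; apply/funext => x; rewrite mul1r.
Qed.

Let Msum y (I : Type) (s : seq I) (e : I -> nat) (F : I -> G -> C) :
  (forall i, cbounded (F i)) ->
  M y (fun x => \sum_(i <- s) (-1) ^+ e i * F i x) =
  \sum_(i <- s) (-1) ^+ e i * M y (F i).
Proof.
move=> bF; elim: s => [|i s IH].
  by rewrite big_nil -[RHS](Mcst y); congr M; apply/funext => x; rewrite big_nil.
rewrite big_cons -IH -Msign// -MD//.
- by congr M; apply/funext => x; rewrite big_cons.
- by have [K FK] := bF i; exists K => x; rewrite cabs_sign.
- exact: cbounded_sum.
Qed.

(* In the homogeneous picture, where G acts on functions on G \ {e} by
   conjugation, this averages the first argument of the cocycle against the mean
   attached to the point of evaluation.  That point is gprod t * h because
   twisting by the right action turns delta_h - delta_(gprod t)^-1 into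
   delta_(gprod t * h) - delta_e. *)
Definition primitive (t : 'I_n -> G) (h : G) : C :=
  M (gmul (gprod t) h) (fun x =>
    on_deltas T (gcons (ginv x) t) (gmul h x) (gmul (ginv (gprod t)) x)).

Lemma primitive_bound : exists B, forall t h, cabs (primitive t h) <= B.
Proof.
have [K TK] := on_deltas_bound bT; exists (2 * K) => t h.
by apply: Mbound => x; exact: TK.
Qed.

(** For each x, the cocycle identity at (x^-1, t), evaluated at the difference of the point masses
    at h x and P^-1 x, expresses the right-hand side through [F0], [Fi] and [Fl]. The mean at P h of
    this identity is the claim, once every primitive on the left is written as a mean at that same
    point. *)
Lemma primitive_coboundary (t : 'I_n.+1 -> G) (h : G) :
  primitive (gtail t) (gmul h (t ord0))
  + \sum_(i < n) (-1) ^+ i.+1 * primitive (gmerge t i) h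
  + (-1) ^+ n.+1 * primitive (ginit t) (gmul (t ord_max) h) =
  on_deltas T t h (ginv (gprod t)).
Proof.
have [K TK] := on_deltas_bound bT.
set P := gprod t.
pose F0 x := on_deltas T (gcons (gmul (ginv x) (t ord0)) (gtail t))
  (gmul h x) (gmul (ginv P) x).
pose Fi (i : 'I_n) x := on_deltas T (gcons (ginv x) (gmerge t i))
  (gmul h x) (gmul (ginv P) x).
pose Fl x := on_deltas T (gcons (ginv x) (ginit t))
  (gmul (t ord_max) (gmul h x)) (gmul (t ord_max) (gmul (ginv P) x)).
have b0 : cbounded F0 by exists K => x; exact: TK.
have bi i : cbounded (Fi i) by exists K => x; exact: TK.
have bl : cbounded Fl by exists K => x; exact: TK.
(* Moving t_0 onto h conjugates the point of evaluation by t_0^-1, hence [Mconj]. The resulting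
   substitution of t_0^-1 x for x turns x^-1 into x^-1 t_0. *)
have -> : primitive (gtail t) (gmul h (t ord0)) = M (gmul P h) F0.
  rewrite /primitive; set Q := gprod (gtail t).
  have EP : P = gmul (t ord0) Q by exact: gprod_tail.
  have EQ : ginv Q = gmul (ginv P) (t ord0).
    by rewrite EP ginvM -gmulA gmulVg gmulg1.
  have [Ph1|Ph1] := pselect (gmul P h = gone G).
    have hP : h = ginv P by rewrite -[h](gmulKg P) Ph1 gmulg1.
    rewrite (_ : F0 = fun=> 0) ?Mcst; last first.
      by apply/funext => x; rewrite /F0 hP on_deltas_self.
    rewrite -[RHS](Mcst (gmul Q (gmul h (t ord0)))); congr M; apply/funext => x.
    by rewrite EQ hP on_deltas_self.
  have -> : gmul Q (gmul h (t ord0)) = conjugate (ginv (t ord0)) (gmul P h).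
    by rewrite /conjugate ginvK EP -!gmulA gmulKg.
  rewrite Mconj//; last by exists K => x; exact: TK.
  congr M; apply/funext => x; rewrite EQ /F0 ginvM ginvK.
  by rewrite -!gmulA !gmulVKg.
have -> : \sum_(i < n) (-1) ^+ i.+1 * primitive (gmerge t i) h =
    \sum_(i < n) (-1) ^+ i.+1 * M (gmul P h) (Fi i).
  by apply: eq_bigr => i _; rewrite /primitive gprod_merge.
(* Moving the last entry from the tuple onto h leaves the product P h unchanged, so the mean is
   already the right one. *)
have -> : primitive (ginit t) (gmul (t ord_max) h) = M (gmul P h) Fl.
  rewrite /primitive; set Q := gprod (ginit t).
  have EP : P = gmul Q (t ord_max) by exact: gprod_init.
  have EQ : ginv Q = gmul (t ord_max) (ginv P).
    by rewrite EP ginvM gmulVKg.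
  rewrite gmulA -EP EQ; congr M; apply/funext => x.
  by rewrite /Fl -!gmulA.
have bs : cbounded (fun x => \sum_(i < n) (-1) ^+ i.+1 * Fi i x).
  exact: (cbounded_sum (index_enum 'I_n) (fun i : 'I_n => i.+1) bi).
have bl' : cbounded (fun x => (-1) ^+ n.+1 * Fl x).
  by exists K => x; rewrite cabs_sign; exact: TK.
have b0s : cbounded (fun x => F0 x + \sum_(i < n) (-1) ^+ i.+1 * Fi i x).
  have [[L0 FL0] [L FL]] := (b0, bs).
  by exists (L0 + L) => x; rewrite (le_trans (cabsD _ _))//; exact: lerD.
rewrite -(Msum _ _ (fun i : 'I_n => i.+1) bi) -Msign// -!MD//.
rewrite -[RHS](Mcst (gmul P h)); congr M; apply/funext => x.
have sd : all_l1 (fun i => delta (gcons (ginv x) t i)).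
  by move=> i; exact: is_l1_delta.
(* The leading term is free of x because h x x^-1 = h. The extra entry x^-1 shifts all other indices
   by one, which gives those terms the opposite sign. *)
have := cocycle sd (in_I0_delta_diff R (gmul h x) (gmul (ginv P) x)).
rewrite coboundary_deltas gtail_cons gcons_ord0 -!gmulA gmulgV !gmulg1.
rewrite big_ord_recl gmerge_cons0 expr1 mulN1r -/(F0 x).
rewrite ginit_cons gcons_max -/(Fl x).
under eq_bigr do rewrite gmerge_consS -/(Fi _ x) lift0 exprS -mulrA.
rewrite -mulr_sumr [(-1) ^+ n.+2]exprS.
move: (\sum_(i < n) _) ((-1) ^+ n.+1) (on_deltas T t _ _) (F0 x) (Fl x).
by move=> S e X a b E; rewrite -[LHS]addr0 -E; ring.
Qed.

End Homotopy.

Theorem theorem3p5 (R : realType) (G : discGroup) :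
  comm_transitive G -> forall n : nat, (1 <= n)%N -> Hvanishes R G n.-1.
Proof.
move=> Gct [//|n] _ T bT cocycle /=.
have [M [MB Mcst Mbound Mconj]] := equivariant_means R Gct.
have [B sB] := primitive_bound Mbound bT.
have bS := bounded_cochain_extend sB.
exists (extend (primitive M T)); split=> // a sa x Ix.
apply/eqP; rewrite -subr_eq0 -mulN1r; apply/eqP.
pose D : cochain R G n.+1 :=
  fun a x => T a x + (-1) * coboundary (extend (primitive M T)) a x.
apply: (@bounded_cochain_delta_ind _ _ _ D) => // [|t y].
  by apply: bounded_cochainD => //; exact: bounded_cochain_coboundary.
have E u v (s : 'I_n -> G) : on_deltas (extend (primitive M T)) s u v =
    primitive M T s u - primitive M T s v by exact: extend_delta_diff.
(* The primitive reproduces T relative to the base point (gprod t)^-1. Subtracting the identities at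
   h = y and h = e cancels this base point and leaves T at the difference of the point masses at y
   and e. *)
have Py := primitive_coboundary MB Mcst Mconj bT cocycle t y.
have P1 := primitive_coboundary MB Mcst Mconj bT cocycle t (gone G).
rewrite /D coboundary_deltas !E -/(on_deltas T t y (gone G)).
rewrite (on_deltasD bT t y (gone G) (ginv (gprod t))) -Py -P1.
have -> : \sum_(i < n) (-1) ^+ i.+1 *
      on_deltas (extend (primitive M T)) (gmerge t i) y (gone G) =
    \sum_(i < n) (-1) ^+ i.+1 * primitive M T (gmerge t i) y -
    \sum_(i < n) (-1) ^+ i.+1 * primitive M T (gmerge t i) (gone G).
  by rewrite -sumrB; apply: eq_bigr => i _; rewrite E mulrBr.
by ring.
Qed.
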